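(* Let $k$ be a field, let $G$ be a finite simple graph with vertex set $V_G=\{x_1,\ldots,x_n\}$, and let $I(G)\subseteq R=k[x_1,\ldots,x_n]$ be its edge ideal. If $G$ has no induced $4$-cycles, then $$\beta_{i,i+2}(I(G)) = \sum_{v \in V_G} \binom{\deg v}{i+1} - k_{i+2}(G)\quad\text{for all } i \geq 0.$$ Furthermore, the formula $\beta_{i,i+2}(I(G)) = \sum_{v \in V_G} \binom{\deg v}{i+1} - k_{i+2}(G)$ holds for all simple graphs $G$ (with no hypothesis on induced $4$-cycles) if $i=0$ or $i=1$.
   Context: A simple graph has no loops or multiple edges; it need not be connected. The edge ideal of $G$, with edge set $E_G$, is $I(G)=\langle x_ix_j \mid \{x_i,x_j\}\in E_G\rangle\subseteq R=k[x_1,\ldots,x_n]$. For a homogeneous ideal $I\subseteq R$ (standard grading), the graded Betti numbers are $\beta_{i,j}(I)=\dim_k \operatorname{Tor}^R_i(I,k)_j$. The degree $\deg v$ of a vertex $v$ is the number of edges incident to $v$. For $S\subseteq V_G$, $G_S$ denotes the induced subgraph of $G$ on $S$. $G$ has no induced $4$-cycle if $G_S\not\cong C_4$ (the cycle on 4 vertices) for every $S\subseteq V_G$ with $|S|=4$. $k_m(G)$ denotes the number of induced subgraphs of $G$ isomorphic to the complete graph $K_m$, i.e. the number of subsets $S\subseteq V_G$ with $G_S\cong K_m$. *)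

(* Defs.v *)
From HB Require Import structures.
From mathcomp Require Import all_boot all_order all_algebra.
From mathcomp Require Import mpoly.
From Stdlib Require Import ClassicalEpsilon.

Set Implicit Arguments.
Unset Strict Implicit.
Unset Printing Implicit Defensive.

Import GRing.Theory.
Local Open Scope ring_scope.

(* Finite simple graphs on 'I_n, given by a symmetric irreflexive relation    *)
(* [e : rel 'I_n]; symmetry and irreflexivity are assumed where needed.       *)

Definition edges (n : nat) (e : rel 'I_n) : {set {set 'I_n}} :=
  [set [set p.1; p.2] | p : 'I_n * 'I_n & e p.1 p.2].

Definition deg (n : nat) (e : rel 'I_n) (v : 'I_n) : nat :=
  #|[set S in edges e | v \in S]|.

(* The induced subgraph of [e] on [S] is isomorphic to the graph [h] on [U].  *)
Definition induced_iso (n : nat) (e : rel 'I_n) (S : {set 'I_n})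
    (U : finType) (h : rel U) : bool :=
  [exists f : {ffun U -> 'I_n},
    [&& injectiveb f, f @: [set: U] == S &
        [forall x, forall y, e (f x) (f y) == h x y]]].

Definition cycle4 : rel 'I_4 := fun x y => (y == ordS x) || (x == ordS y).

Definition complete (m : nat) : rel 'I_m := fun x y => x != y.

Definition no_induced_C4 (n : nat) (e : rel 'I_n) : Prop :=
  forall S : {set 'I_n}, #|S| = 4 -> ~~ induced_iso e S cycle4.

Definition num_cliques (n : nat) (e : rel 'I_n) (m : nat) : nat :=
  #|[set S : {set 'I_n} | induced_iso e S (@complete m)]|.

Definition edge_ideal (k : fieldType) (n : nat) (e : rel 'I_n)
    (f : {mpoly k[n]}) : Prop :=
  exists c : {set 'I_n} -> {mpoly k[n]},
    f = \sum_(S in edges e) c S * \prod_(i in S) 'X_i.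

(* A sequence ... -> F_1 -> F_0 -> R of graded free modules of finite rank    *)
(* over R = k[x_1, ..., x_n]: F_i is the module of row vectors of length      *)
(* [rk i], whose a-th basis vector has degree [gdeg i a]: F_i is the direct  *)
(* sum of the R(- gdeg i a). Matrices act on row vectors from the right.      *)
Record free_seq (k : fieldType) (n : nat) := FreeSeq {
  rk : nat -> nat;
  gdeg : forall i, 'I_(rk i) -> nat;
  dif : forall i, 'M[{mpoly k[n]}]_(rk i.+1, rk i);
  aug : 'cV[{mpoly k[n]}]_(rk 0)
}.
Arguments gdeg {k n} f i _.

(* [v] is homogeneous of degree [j] in the direct sum of the R(- d a); the    *)
(* zero vector is homogeneous of every degree.                                *)
Definition homog_vec (k : fieldType) (n r : nat) (d : 'I_r -> nat) (j : nat)
    (v : 'rV[{mpoly k[n]}]_r) : Prop :=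
  forall a m, m \in msupp (v 0 a) -> (mdeg m + d a)%N = j.

(* ... -> F_1 -> F_0 -> I -> 0 is exact with maps homogeneous of degree 0.    *)
Record graded_free_resolution (k : fieldType) (n : nat)
    (I : {mpoly k[n]} -> Prop) (F : free_seq k n) : Prop := {
  dif_homog : forall i (a : 'I_(rk F i.+1)),
    homog_vec (gdeg F i) (gdeg F i.+1 a) (row a (dif F i));
  aug_homog : forall a : 'I_(rk F 0), aug F a 0 \is (gdeg F 0 a).-homog;
  aug_onto : forall f, I f <-> exists v : 'rV_(rk F 0), f = (v *m aug F) 0 0;
  exact_aug : forall v : 'rV_(rk F 0),
    v *m aug F = 0 <-> exists w : 'rV_(rk F 1), v = w *m dif F 0;
  exact_dif : forall i (v : 'rV_(rk F i.+1)),
    v *m dif F i = 0 <-> exists w : 'rV_(rk F i.+2), v = w *m dif F i.+1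
}.

Section Tor.

Variables (k : fieldType) (n : nat) (F : free_seq k n).

(* The differential of F tensored with k = R / (x_1, ..., x_n): only the      *)
(* constant terms of the entries survive.                                     *)
Definition dif_k (i : nat) : 'M[k]_(rk F i.+1, rk F i) :=
  map_mx (mcoeff 0%MM) (dif F i).

(* Subspaces are represented by row spaces of matrices. The degree j part of  *)
(* F_i tensor k is spanned by the basis vectors of degree j.                  *)
Definition deg_part (i j : nat) : 'M[k]_(rk F i) :=
  diag_mx (\row_a (gdeg F i a == j)%:R).

Definition cycles (i j : nat) : 'M[k]_(rk F i) :=
  match i with
  | 0 => deg_part 0 j
  | i'.+1 => (deg_part i'.+1 j :&: kermx (dif_k i'))%MS
  end.

Definition boundaries (i j : nat) : 'M[k]_(rk F i.+1, rk F i) :=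
  deg_part i.+1 j *m dif_k i.

(* The dimension of the degree j part of H_i(F tensor k). For a resolution    *)
(* the boundaries lie in the cycles, so the subtraction is exact.             *)
Definition tor_dim (i j : nat) : nat :=
  (\rank (cycles i j) - \rank (boundaries i j))%N.

End Tor.

(* dim_k Tor_i^R(I, k)_j, computed from a graded free resolution of I by      *)
(* modules of finite rank: one exists for every homogeneous ideal I, and the  *)
(* dimension does not depend on the one that is chosen.                       *)
Definition graded_betti (k : fieldType) (n : nat) (I : {mpoly k[n]} -> Prop)
    (i j : nat) : nat :=
  epsilon (inhabits 0%N) (fun b : nat =>
    exists2 F : free_seq k n, graded_free_resolution I F & tor_dim F i j = b).

(* Main.v *)
From HB Require Import structures.
Require Import Defs.
From mathcomp Require Import all_boot all_order all_algebra.
From mathcomp Require Import mpoly.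
From mathcomp Require Import zify.
From Stdlib Require Import ClassicalEpsilon.

Set Implicit Arguments.
Unset Strict Implicit.
Unset Printing Implicit Defensive.

Import GRing.Theory.
Local Open Scope ring_scope.

(** Why the formula holds.

    Write [Tor_i(I(G), k)] in degree [i + 2] as the homology at the [i]-forms
    of the Koszul complex of the variables with values in [I(G)]. An element
    of degree [i + 2] there is an [i]-form with quadratic values in the edge
    ideal, and there are no boundaries, because the ideal has no linear
    elements. So the Betti number is the dimension of the space of cycles
    [edge_cycle i].

    This space splits by multidegree. In a multidegree that is not squarefree
    it is zero ([edge_cycle_overlap]). In the multidegree of a set [S] of
    [i + 2] vertices a cycle amounts, up to signs, to a function [z] on the
    edges of [G_S] that is a [1]-cocycle of the full simplex on [S] once
    extended by [0] to the non-edges. Then [z(p,q) = g(q) - g(p)] with [g]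
    constant on the connected components of the complement of [G_S]. Without
    induced [4]-cycles, or when [S] has at most three elements, at most one of
    these components has more than one vertex; hence, modulo constants, the
    functions [g] are spanned by the indicators of the vertices adjacent to
    all the rest of [S], with one linear relation exactly when [S] is a
    clique. In the Koszul complex such an indicator at [v] is the star
    [ 'X_v * d(e_(S - v)) ], and counting pairs ([v], [S - v]) gives
    [ 'C(deg v, i + 1) ] for every [v], minus one for every clique.
    [edge_cycle_qdim] turns this into a basis and [card_star_basis] into the
    count.

    Two things connect this with the Betti numbers, which are computed from
    an arbitrary graded free resolution [F] of finite rank. First, such a
    resolution exists: Taylor's resolution of the edge ideal
    ([edge_ideal_resolution]). Secondly, the homology of [F] tensored with
    [k] is the Koszul homology of the ideal ([tor_koszul_qdim]); this is the
    comparison of the two edges of the double complex formed by [F] and the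
    Koszul complex, whose augmented rows and columns are exact. The Koszul
    complex is itself the Taylor complex of the variables, so a single
    contraction ([tay_diff_cone]) proves it exact along with Taylor's
    resolution. *)

(** * The Taylor complex of a family of monomials *)

Lemma mcoeffXM (k : fieldType) (n : nat) (m u : 'X_{1..n}) (p : {mpoly k[n]}) :
  ('X_[m] * p)@_u = if (m <= u)%MM then p@_(u - m) else 0.
Proof.
rewrite mulrC; case: ifP => [le_mu|nle_mu].
  by rewrite -{1}(submK le_mu) addmC mcoeffMX.
apply/memN_msupp_eq0/negP; rewrite (perm_mem (msuppMX p m)) => /mapP[m' _ eu].
by move: nle_mu; rewrite eu lem_addr.
Qed.

(** Division by a monomial with a selection of terms: the building block of
    the contraction [cone] and of the projections onto homogeneous parts. *)
Definition divide_terms (k : fieldType) (n : nat) (P : pred 'X_{1..n})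
    (d : 'X_{1..n}) (p : {mpoly k[n]}) : {mpoly k[n]} :=
  \sum_(m : 'X_{1..n < msize p})
    (if P (m + d)%MM then p@_(m + d) else 0) *: 'X_[m].

Lemma mcoeff_divide_terms (k : fieldType) (n : nat) (P : pred 'X_{1..n})
    (d : 'X_{1..n}) (p : {mpoly k[n]}) u :
  (divide_terms P d p)@_u = if P (u + d)%MM then p@_(u + d) else 0.
Proof.
have [lt_u|ge_u] := ltnP (mdeg u) (msize p).
  exact: (mcoeff_mpoly (fun m => if P (m + d)%MM then p@_(m + d) else 0)).
rewrite [p@_(u + d)]memN_msupp_eq0 ?if_same; last first.
  by apply: msize_mdeg_ge; rewrite mdegD (leq_trans ge_u) ?leq_addr.
rewrite raddf_sum big1 //= => m _; rewrite mcoeffZ mcoeffX.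
case: eqP => [eq_mu|_]; last by rewrite mulr0.
by move: (bmdeg m); rewrite eq_mu ltnNge ge_u.
Qed.

Section Taylor.

Variables (k : fieldType) (n N : nat) (mon : 'I_N -> 'X_{1..n}).
Local Notation R := {mpoly k[n]}.
Implicit Types (A B : {set 'I_N}) (i j s : 'I_N) (u m : 'X_{1..n}).

Definition mlcms A : 'X_{1..n} := [multinom (\max_(i in A) mon i v)%N | v < n].

Definition below i B := #|[set b in B | (b < i)%N]|.

(** A chain assigns to every set of generators its coefficient. Coefficients
    are taken in [R^r], so that the same complex can be tensored with the
    terms of a free resolution. *)
Definition tay_diff r (x : {ffun {set 'I_N} -> 'rV[R]_r}) :
    {ffun {set 'I_N} -> 'rV[R]_r} :=
  [ffun B : {set 'I_N} => \sum_(i | i \notin B)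
    ((-1) ^+ below i B * 'X_[mlcms (i |: B) - mlcms B]) *: x (i |: B)].

Lemma tay_diff_is_linear r : linear (@tay_diff r).
Proof.
move=> c x y; apply/ffunP=> B; rewrite !ffunE scaler_sumr -big_split /=.
by apply: eq_bigr => i _; rewrite !ffunE scalerDr !scalerA [_ * c]mulrC.
Qed.

HB.instance Definition _ r := GRing.isLinear.Build R
  {ffun {set 'I_N} -> 'rV[R]_r} {ffun {set 'I_N} -> 'rV[R]_r} *:%R
  (@tay_diff r) (@tay_diff_is_linear r).

Lemma mlcms_le A u :
  reflect (forall i, i \in A -> (mon i <= u)%MM) (mlcms A <= u)%MM.
Proof.
apply: (iffP mnm_lepP) => [le_Au i Ai | le_iu v].
  apply/mnm_lepP=> v; apply: leq_trans (le_Au v); rewrite mnmE.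
  exact: (@leq_bigmax_cond _ (mem A) (fun i => mon i v) i Ai).
rewrite mnmE; apply/bigmax_leqP=> i Ai; exact: (mnm_lepP (le_iu i Ai)).
Qed.

Lemma mlcmsU1_le i A u :
  (mlcms (i |: A) <= u)%MM = (mon i <= u)%MM && (mlcms A <= u)%MM.
Proof.
apply/mlcms_le/andP=> [le_u|[le_iu /mlcms_le le_Au] j].
  split; first by apply: le_u; rewrite setU11.
  by apply/mlcms_le=> j Aj; apply: le_u; rewrite setU1r.
by rewrite !inE => /predU1P[->//|]; apply: le_Au.
Qed.

Lemma mlcms0 : mlcms set0 = 0%MM.
Proof. by apply/mnmP=> v; rewrite mnmE big_set0 mnm0E. Qed.

Lemma mlcms1 i : mlcms [set i] = mon i.
Proof. by apply/mnmP=> v; rewrite mnmE big_set1. Qed.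

Lemma mlcmsS A B : A \subset B -> (mlcms A <= mlcms B)%MM.
Proof.
move=> /subsetP sAB; apply/mlcms_le=> i /sAB Bi.
exact: (mlcms_le _ _ (lepm_refl _)).
Qed.

(** The basis element indexed by [A] has multidegree [mlcms A]; this is why the
    exponent is shifted. *)
Definition mdcoef r u (x : {ffun {set 'I_N} -> 'rV[R]_r}) A (a : 'I_r) : k :=
  if (mlcms A <= u)%MM then (x A 0 a)@_(u - mlcms A) else 0.

(** In a fixed multidegree, the powers of the variables disappear and the
    differential becomes the boundary map of a simplex. *)
Lemma mdcoef_diff r u (x : {ffun {set 'I_N} -> 'rV[R]_r}) B a :
  (mlcms B <= u)%MM ->
  mdcoef u (tay_diff x) B a =
    \sum_(i | i \notin B) (-1) ^+ below i B * mdcoef u x (i |: B) a.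
Proof.
move=> leBu; rewrite /mdcoef leBu ffunE summxE raddf_sum /=.
apply: eq_bigr => i niB; rewrite mxE -mulrA -signr_odd.
have -> : ((-1) ^+ odd (below i B) : R) = ((-1) ^+ odd (below i B))%:MP.
  by rewrite rmorph_sign.
rewrite mcoeffCM signr_odd mcoeffXM; congr (_ * _).
have leB : (mlcms B <= mlcms (i |: B))%MM by apply/mlcmsS/subsetUr.
have -> : (mlcms (i |: B) - mlcms B <= u - mlcms B)%MM
        = (mlcms (i |: B) <= u)%MM.
  apply/mnm_lepP/mnm_lepP => le v; move: (le v); rewrite !mnmBE.
    by have := mnm_lepP leB v; have := mnm_lepP leBu v; lia.
  by have := mnm_lepP leB v; have := mnm_lepP leBu v; lia.
case: ifP => // _; congr (_@__); apply/mnmP=> v; rewrite !mnmBE.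
by rewrite subnBA ?subnK //; apply: mnm_lepP v.
Qed.

Lemma mdcoefP r (x y : {ffun {set 'I_N} -> 'rV[R]_r}) :
  (forall u A a, (mlcms A <= u)%MM -> mdcoef u x A a = mdcoef u y A a) ->
  x = y.
Proof.
move=> eq_xy; apply/ffunP=> A; apply/rowP=> a; apply/mpolyP=> m.
have := eq_xy (m + mlcms A)%MM A a; rewrite /mdcoef lem_addl => /(_ isT).
by rewrite addmK.
Qed.

Lemma belowU1 i j B : i \notin B ->
  below j (i |: B) = ((i < j) + below j B)%N.
Proof.
move=> niB; rewrite /below; case: (boolP (i < j)%N) => [ij|nij].
  have -> : [set b in i |: B | (b < j)%N] = i |: [set b in B | (b < j)%N].
    by apply/setP=> b; rewrite !inE; case: eqP => [->|].
  by rewrite cardsU1 !inE (negPf niB).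
rewrite add0n; congr #|pred_of_set _|; apply/setP=> b; rewrite !inE.
by case: eqP => [->|//]; rewrite (negPf nij) (negPf niB).
Qed.

Lemma below0 i : below i set0 = 0%N.
Proof. by apply/eqP; rewrite cards_eq0; apply/eqP/setP=> b; rewrite !inE. Qed.

(** The sign rule behind [tay_diffK]: of two elements, the larger one counts
    the smaller one exactly when it is added last. *)
Lemma below_swap i j B : i \notin B -> j \notin B -> i != j ->
  odd (below i B + below j (i |: B)) = ~~ odd (below j B + below i (j |: B)).
Proof.
move=> niB njB; rewrite -val_eqE !belowU1 // !oddD !oddb /=.
by case: ltngtP => // _ _; do 2!case: (odd _).
Qed.

Lemma tay_diffK r (x : {ffun {set 'I_N} -> 'rV[R]_r}) :
  tay_diff (tay_diff x) = 0.
Proof.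
apply: mdcoefP => u B a leBu; rewrite mdcoef_diff //.
have -> : mdcoef u (0 : {ffun {set 'I_N} -> 'rV[R]_r}) B a = 0.
  by rewrite /mdcoef leBu ffunE mxE mcoeff0.
pose F i j := (-1) ^+ (below i B + below j (i |: B))
                * mdcoef u x (j |: (i |: B)) a.
transitivity (\sum_i \sum_(j | [&& i \notin B, j \notin B & i != j]) F i j).
  rewrite [RHS](bigID (fun i => i \in B)) /= [X in _ = X + _]big1 ?add0r.
    apply: eq_bigr => i niB; rewrite niB /=.
    have [leu|nleu] := boolP (mlcms (i |: B) <= u)%MM.
      rewrite mdcoef_diff // big_distrr /=; apply: eq_big => j.
        by rewrite !inE negb_or andbC eq_sym.
      by move=> _; rewrite /F exprD mulrA.
    rewrite {1}/mdcoef (negPf nleu) mulr0 big1 // => j _.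
    rewrite /F /mdcoef; case: ifP => [le|_]; last by rewrite mulr0.
    by case/negP: nleu; apply: lepm_trans le; apply/mlcmsS/subsetUr.
  by move=> i Bi; rewrite big_pred0 // => j; rewrite Bi.
(* the terms with [i < j] cancel those with [j < i] by [below_swap] *)
transitivity (\sum_i \sum_(j | [&& i \notin B, j \notin B & (i < j)%N]) F i j
  + \sum_i \sum_(j | [&& i \notin B, j \notin B & (j < i)%N]) F i j).
  rewrite -big_split /=; apply: eq_bigr => i _.
  rewrite (bigID (fun j : 'I_N => (i < j)%N)) /=; congr (_ + _);
    by apply: eq_bigl => j; rewrite -val_eqE /=; case: (_ \in _) => //=;
       case: (_ \in _) => //=; lia.
rewrite [X in _ + X](exchange_big_dep xpredT) //= -big_split big1 //= => i _.
rewrite [X in _ + X](eq_bigl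
  (fun j => [&& i \notin B, j \notin B & (i < j)%N])); last first.
  by move=> j; rewrite andbCA.
rewrite -big_split big1 //= => j /and3P[niB njB ij].
rewrite /F setUCA -mulrDl -signr_odd below_swap //; last first.
  by rewrite -val_eqE neq_ltn ij.
by rewrite signrN signr_odd addNr mul0r.
Qed.

Definition apex u s :=
  (mon s <= u)%MM && [forall i, (mon i <= u)%MM ==> (s <= i)%N].

Lemma apex_exists u i : (mon i <= u)%MM -> exists s, apex u s.
Proof.
move=> le_iu; exists [arg min_(s < i | (mon s <= u)%MM) (s : nat)].
case: arg_minnP => // s le_su min_s; rewrite /apex le_su.
by apply/forallP=> j; apply/implyP; apply: min_s.
Qed.

Lemma apex_le u s i : apex u s -> (mon i <= u)%MM -> (s <= i)%N.
Proof. by case/andP=> _ /forallP/(_ i)/implyP. Qed.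

Lemma apex_uniq u s t : apex u s -> apex u t -> s = t.
Proof.
move=> us ut; apply/val_inj/anti_leq; move: (us) (ut).
by case/andP=> le_s _ /andP[le_t _]; rewrite /= (apex_le us) // (apex_le ut).
Qed.

(** The cone over the simplex of the generators dividing [u], with the least
    such generator as apex: being least, it enters every set with sign [1]. *)
Definition cone r (x : {ffun {set 'I_N} -> 'rV[R]_r}) :
    {ffun {set 'I_N} -> 'rV[R]_r} :=
  [ffun A : {set 'I_N} => \row_a \sum_(s in A)
    divide_terms (fun m => apex (m + mlcms (A :\ s)) s)
            (mlcms A - mlcms (A :\ s)) (x (A :\ s) 0 a)].

Lemma mdcoef_cone r u (x : {ffun {set 'I_N} -> 'rV[R]_r}) A a :
  mdcoef u (cone x) A a =
    \sum_(s in A | apex u s) mdcoef u x (A :\ s) a.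
Proof.
rewrite {1}/mdcoef; case: ifP => [leAu|/negP nleAu]; last first.
  rewrite big1 // => s /andP[As /andP[le_su _]]; rewrite /mdcoef.
  case: ifP => // leu; case: nleAu.
  by rewrite -(setD1K As) mlcmsU1_le le_su.
rewrite ffunE mxE raddf_sum big_mkcondr; apply: eq_bigr => s As /=.
have leA : (mlcms (A :\ s) <= mlcms A)%MM by apply/mlcmsS/subD1set.
rewrite mcoeff_divide_terms /mdcoef (lepm_trans leA leAu).
have -> : (u - mlcms A + (mlcms A - mlcms (A :\ s)) = u - mlcms (A :\ s))%MM.
  apply/mnmP=> v; rewrite !(mnmDE, mnmBE) addnBA ?subnK //.
    exact: (mnm_lepP leAu).
  exact: (mnm_lepP leA).
by rewrite submK // (lepm_trans leA leAu).
Qed.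

(** The Taylor complex is exact because in multidegree [u] it is the chain
    complex of the full simplex on the generators that divide [u], which
    contracts to its apex. If no generator divides [u], only the empty set
    is left; the hypothesis on [x set0] says that [x] vanishes there. *)
Lemma tay_diff_cone r (x : {ffun {set 'I_N} -> 'rV[R]_r}) :
  tay_diff x = 0 ->
  (forall a m, m \in msupp (x set0 0 a) -> exists i, (mon i <= m)%MM) ->
  tay_diff (cone x) = x.
Proof.
move=> dx0 x0_ideal; apply: mdcoefP => u B a leBu; rewrite mdcoef_diff //.
case: (pickP (apex u)) => [s us|no_apex]; last first.
  have gen_u i : (mon i <= u)%MM = false.
    by apply/negP=> /apex_exists[s]; rewrite no_apex.
  rewrite big1 => [|i _]; last first.
    by rewrite mdcoef_cone big_pred0 ?mulr0 // => j; rewrite no_apex andbF.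
  rewrite /mdcoef leBu; case: (set_0Vmem B) => [->|[i Bi]]; last first.
    by have := mlcms_le _ _ leBu i Bi; rewrite gen_u.
  rewrite memN_msupp_eq0 //; apply/negP=> /x0_ideal[i].
  have -> : (u - mlcms set0 = u)%MM.
    by apply/mnmP=> v; rewrite mnmBE mlcms0 mnm0E subn0.
  by rewrite gen_u.
have coneE A : mdcoef u (cone x) A a =
    if s \in A then mdcoef u x (A :\ s) a else 0.
  rewrite mdcoef_cone; case: ifP => As.
    rewrite (big_pred1 s) // => t; apply/andP/eqP => [[_ ut]|->//].
    exact: apex_uniq ut us.
  rewrite big_pred0 // => t; apply/negP=> /andP[At ut].
  by rewrite (apex_uniq us ut) At in As.
have below_s B' : (mlcms B' <= u)%MM -> below s B' = 0%N.
  move=> leB'; apply/eqP; rewrite cards_eq0; apply/eqP/setP=> b; rewrite !inE.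
  apply/negP=> /andP[B'b]; rewrite ltnNge (apex_le us) //.
  exact: (mlcms_le _ _ leB').
have [Bs|nBs] := boolP (s \in B); last first.
  rewrite (bigD1 s) //= coneE setU11 setU1K // below_s // mul1r.
  rewrite big1 ?addr0 // => i /andP[_ ne_is].
  by rewrite coneE !inE eq_sym (negPf ne_is) (negPf nBs) mulr0.
(* a face through the apex: the cycle condition at [B'] expresses the
   coefficient at [B] by those at the sets [i |: B'] with [i <> s] *)
pose B' := B :\ s; have nB's : s \notin B' by rewrite !inE eqxx.
have leB' : (mlcms B' <= u)%MM.
  by apply: lepm_trans leBu; apply/mlcmsS/subD1set.
have := mdcoef_diff x a leB'; rewrite dx0 {1}/mdcoef leB' ffunE mxE mcoeff0.
rewrite (bigD1 s) //= below_s // mul1r setD1K // => /esym/eqP.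
rewrite addr_eq0 => /eqP->; rewrite -sumrN; apply: eq_big => i.
  by rewrite !inE; case: eqP => [->|]; rewrite ?Bs ?andbT.
move=> niB; rewrite coneE setU1r //.
have ne_is : i != s by apply: contraNneq niB => ->.
have -> : (i |: B) :\ s = i |: B'.
  by apply/setP=> j; rewrite !inE; case: (j =P i) => [->|]; rewrite ?ne_is.
have [le_iu|nle_iu] := boolP (mon i <= u)%MM; last first.
  by rewrite /mdcoef mlcmsU1_le (negPf nle_iu) !mulr0 oppr0.
rewrite -{1}(setD1K Bs) belowU1 // ltn_neqAle (apex_le us) //.
by rewrite val_eqE eq_sym ne_is add1n exprS mulN1r mulNr.
Qed.

Lemma mdcoef_neq0 r u (x : {ffun {set 'I_N} -> 'rV[R]_r}) A a :
  mdcoef u x A a != 0 ->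
  exists2 m, m \in msupp (x A 0 a) & (m + mlcms A = u)%MM.
Proof.
rewrite /mdcoef; case: ifP => [leAu nz|_]; last by rewrite eqxx.
by exists (u - mlcms A)%MM; rewrite ?mcoeff_msupp ?submK.
Qed.

Lemma mdcoef_msupp r (x : {ffun {set 'I_N} -> 'rV[R]_r}) A a m :
  m \in msupp (x A 0 a) -> mdcoef (m + mlcms A) x A a != 0.
Proof. by rewrite mcoeff_msupp /mdcoef lem_addl addmK. Qed.

(** The differential and the cone preserve multidegrees. The next two lemmas
    say this for the monomials that occur, and all statements on degrees come
    from them. *)
Lemma msupp_tay_diff r (x : {ffun {set 'I_N} -> 'rV[R]_r}) B a m :
  m \in msupp (tay_diff x B 0 a) ->
  exists i m', [/\ i \notin B, m' \in msupp (x (i |: B) 0 a) &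
                   (m' + mlcms (i |: B) = m + mlcms B)%MM].
Proof.
move=> /mdcoef_msupp; rewrite mdcoef_diff ?lem_addl // => nz.
have [i /andP[niB nzi]|all0] := pickP (fun i => (i \notin B) &&
    (mdcoef (m + mlcms B) x (i |: B) a != 0)).
  by have [m' xm' em'] := mdcoef_neq0 nzi; exists i, m'.
case/negP: nz; apply/eqP/big1 => i niB.
by have := all0 i; rewrite niB /= => /eqP->; rewrite mulr0.
Qed.

Lemma msupp_cone r (x : {ffun {set 'I_N} -> 'rV[R]_r}) A a m :
  m \in msupp (cone x A 0 a) ->
  exists s m', [/\ s \in A, m' \in msupp (x (A :\ s) 0 a) &
                   (m' + mlcms (A :\ s) = m + mlcms A)%MM].
Proof.
move=> /mdcoef_msupp; rewrite mdcoef_cone => nz.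
have [s /andP[As nzs]|all0] := pickP (fun s => (s \in A) &&
    (mdcoef (m + mlcms A) x (A :\ s) a != 0)).
  by have [m' xm' em'] := mdcoef_neq0 nzs; exists s, m'.
case/negP: nz; apply/eqP/big1 => s /andP[As _].
by have := all0 s; rewrite As /= => /eqP.
Qed.

End Taylor.

(** * Taylor's resolution of a monomial ideal *)

Section TaylorResolution.

Variables (k : fieldType) (n N : nat) (mon : 'I_N -> 'X_{1..n}).
Local Notation R := {mpoly k[n]}.
Local Notation subset_of_size p := {A : {set 'I_N} | #|A| == p}.
Local Notation chain := {ffun {set 'I_N} -> 'rV[R]_1}.
Implicit Types (A B : {set 'I_N}) (x : chain) (p : nat).

Definition basis_set p (a : 'I_#|{: subset_of_size p}|) : {set 'I_N} :=
  val (enum_val a).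

(** The sum has at most one term. Written as a sum, it turns a matrix product
    into [tay_diff] by an exchange of summations. *)
Definition face_coef A B : R :=
  \sum_(i | (i \notin B) && (i |: B == A))
    (-1) ^+ below i B * 'X_[mlcms mon A - mlcms mon B].

Definition taylor_dif p :
    'M[R]_(#|{: subset_of_size p.+1}|, #|{: subset_of_size p}|) :=
  \matrix_(a, b) face_coef (basis_set a) (basis_set b).

(** The empty set accounts for [R] itself, so the subsets of size [i + 1] form
    the basis of the [i]-th module of a resolution of the ideal. *)
Definition taylor_seq : free_seq k n :=
  @FreeSeq k n (fun i => #|{: subset_of_size i.+1}|)
    (fun i a => mdeg (mlcms mon (basis_set a)))
    (fun i => taylor_dif i.+1)
    (\col_a face_coef (basis_set a) set0).

Definition chain_of p (v : 'rV[R]_#|{: subset_of_size p}|) : chain :=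
  [ffun A => \row__ \sum_(a | basis_set a == A) v 0 a].

Definition row_of p x : 'rV[R]_#|{: subset_of_size p}| :=
  \row_a x (basis_set a) 0 0.

Lemma card_basis_set p (a : 'I_#|{: subset_of_size p}|) : #|basis_set a| = p.
Proof. exact/eqP/(valP (enum_val a)). Qed.

Lemma basis_set_inj p : injective (@basis_set p).
Proof. by move=> a b /val_inj /enum_val_inj. Qed.

Lemma basis_set_onto p A : #|A| = p -> exists a, @basis_set p a = A.
Proof.
move=> /eqP sA; exists (enum_rank (exist (fun A => #|A| == p) A sA)).
by rewrite /basis_set enum_rankK.
Qed.

Lemma chain_ofK p : cancel (@chain_of p) (@row_of p).
Proof.
move=> v; apply/rowP=> a; rewrite mxE ffunE mxE (big_pred1 a) // => b.
exact: (inj_eq (@basis_set_inj p)).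
Qed.

Lemma chain_of_eq0 p (v : 'rV[R]_#|{: subset_of_size p}|) A :
  #|A| != p -> chain_of v A = 0.
Proof.
move=> sA; apply/rowP=> c; rewrite ffunE !mxE big_pred0 // => a.
by apply: contraNF sA => /eqP<-; rewrite card_basis_set.
Qed.

Lemma row_of_face p x B : #|B| = p ->
  \sum_(a < _) row_of p.+1 x 0 a * face_coef (basis_set a) B
    = tay_diff mon x B 0 0.
Proof.
move=> sB; rewrite ffunE summxE /face_coef.
under eq_bigr do rewrite big_distrr /=.
rewrite (exchange_big_dep (fun i => i \notin B)) /=; last first.
  by move=> a i _ /andP[].
apply: eq_bigr => i niB; rewrite mxE.
have [a Ba] : exists a, @basis_set p.+1 a = i |: B.
  by apply: basis_set_onto; rewrite cardsU1 niB sB.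
rewrite (big_pred1 a) => [|b]; last first.
  by rewrite niB -Ba eq_sym (inj_eq (@basis_set_inj _)).
by rewrite mxE Ba mulrC.
Qed.

Lemma row_of_dif p x :
  row_of p.+1 x *m taylor_dif p = row_of p (tay_diff mon x).
Proof.
apply/rowP=> b; rewrite !mxE -(row_of_face _ (card_basis_set b)).
by apply: eq_bigr => a _; rewrite [taylor_dif _ _ _]mxE.
Qed.

Lemma tay_diff_chain_of p (v : 'rV[R]_#|{: subset_of_size p.+1}|) B :
  #|B| != p -> tay_diff mon (chain_of v) B = 0.
Proof.
move=> sB; rewrite ffunE big1 // => i niB.
by rewrite chain_of_eq0 ?scaler0 // cardsU1 niB.
Qed.

(** The cone adds one element to a set, so the contraction of the whole Taylor
    complex is compatible with the sizes of the sets. *)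
Lemma tay_cycle_dif p (v : 'rV[R]_#|{: subset_of_size p.+1}|) :
  tay_diff mon (chain_of v) = 0 -> exists w, v = w *m taylor_dif p.+1.
Proof.
move=> dv0; exists (row_of p.+2 (cone mon (chain_of v))).
rewrite row_of_dif tay_diff_cone ?chain_ofK // => a m.
by rewrite chain_of_eq0 ?cards0 // mxE msupp0.
Qed.

Lemma row_of0 p : row_of p 0 = 0.
Proof. by apply/rowP=> a; rewrite !mxE ffunE mxE. Qed.

Lemma taylor_dif_exact p (v : 'rV[R]_#|{: subset_of_size p.+2}|) :
  v *m taylor_dif p.+1 = 0 <-> exists w, v = w *m taylor_dif p.+2.
Proof.
split=> [vd0|[w ->]]; last first.
  by rewrite -(chain_ofK w) !row_of_dif tay_diffK row_of0.
apply: tay_cycle_dif; apply/ffunP=> B; rewrite [RHS]ffunE.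
have [/basis_set_onto[b <-]|sB] := eqVneq #|B| p.+1; last first.
  exact: tay_diff_chain_of.
have := row_of_dif p.+1 (chain_of v); rewrite chain_ofK vd0 => /rowP/(_ b).
by rewrite !mxE => tb0; apply/rowP=> c; rewrite ord1 -tb0 mxE.
Qed.

Lemma chain_of_aug (v : 'rV[R]_#|{: subset_of_size 1}|) :
  (v *m aug taylor_seq) 0 0 = tay_diff mon (chain_of v) set0 0 0.
Proof.
rewrite -(@row_of_face 0) ?cards0 // chain_ofK mxE.
by apply: eq_bigr => a _; rewrite mxE.
Qed.

Lemma taylor_aug_exact (v : 'rV[R]_#|{: subset_of_size 1}|) :
  v *m aug taylor_seq = 0 <-> exists w, v = w *m taylor_dif 1.
Proof.
split=> [va0|[w ->]]; last first.
  apply/rowP=> c; rewrite ord1 chain_of_aug -(chain_ofK w) row_of_dif.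
  rewrite -(@row_of_face 0) ?cards0 //.
  transitivity (tay_diff mon (tay_diff mon (chain_of w)) set0 0 0).
    rewrite -(@row_of_face 0) ?cards0 //; apply: eq_bigr => a _.
    by rewrite chain_ofK.
  by rewrite tay_diffK ffunE !mxE.
apply: tay_cycle_dif; apply/ffunP=> B; rewrite [RHS]ffunE.
have [/eqP|sB] := eqVneq #|B| 0%N; last exact: tay_diff_chain_of.
rewrite cards_eq0 => /eqP->; apply/rowP=> c.
by rewrite ord1 -chain_of_aug va0.
Qed.

Lemma msupp_face_coef A B m : m \in msupp (face_coef A B) ->
  (mdeg m + mdeg (mlcms mon B))%N = mdeg (mlcms mon A).
Proof.
rewrite mcoeff_msupp raddf_sum /=.
have [->|ne_m] := eqVneq m (mlcms mon A - mlcms mon B)%MM; last first.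
  rewrite big1 ?eqxx // => i _; rewrite -signr_odd.
  have -> : ((-1) ^+ odd (below i B) : R) = ((-1) ^+ odd (below i B))%:MP.
    by rewrite rmorph_sign.
  by rewrite mcoeffCM mcoeffX eq_sym (negPf ne_m) mulr0.
case: (pickP (fun i => (i \notin B) && (i |: B == A))) => [i|none]; last first.
  by rewrite big_pred0 ?eqxx.
case/andP=> _ /eqP<- _; rewrite -mdegD submK //; apply/mlcmsS/subsetUr.
Qed.

Definition monomial_ideal (f : R) : Prop :=
  exists c : 'I_N -> R, f = \sum_i c i * 'X_[mon i].

Lemma taylor_aug_onto f :
  monomial_ideal f <->
  exists v : 'rV[R]_#|{: subset_of_size 1}|, f = (v *m aug taylor_seq) 0 0.
Proof.
have aug1 x : tay_diff mon x set0 0 0 = \sum_i x [set i] 0 0 * 'X_[mon i].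
  rewrite ffunE summxE; apply: eq_big => [i|i _]; first by rewrite inE.
  by rewrite mxE setU0 below0 mul1r mlcms1 mlcms0 subm0 mulrC.
split=> [[c ->]|[v ->]]; last first.
  by exists (fun i => chain_of v [set i] 0 0); rewrite chain_of_aug aug1.
pose x : chain := [ffun A => \row__ \sum_(i | A == [set i]) c i].
exists (row_of 1 x); rewrite mxE.
transitivity (tay_diff mon x set0 0 0).
  rewrite aug1; apply: eq_bigr => i _; rewrite ffunE mxE (big_pred1 i) // => j.
  by rewrite eq_sym (inj_eq set1_inj).
rewrite -(@row_of_face 0) ?cards0 //; apply: eq_bigr => a _.
by rewrite !mxE.
Qed.

(** Exactness comes from the contraction [cone], and homogeneity from the fact
    that a face loses exactly the degree of the monomial it is multiplied
    with. *)
Lemma taylor_resolution : graded_free_resolution monomial_ideal taylor_seq.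
Proof.
split.
- by move=> i a b m; rewrite !mxE => /msupp_face_coef.
- move=> a; apply/dhomogP=> m; rewrite mxE => /msupp_face_coef.
  by rewrite mlcms0 mdeg0 addn0.
- exact: taylor_aug_onto.
- exact: taylor_aug_exact.
- move=> i; exact: taylor_dif_exact.
Qed.

End TaylorResolution.

Lemma edge_ideal_resolution (k : fieldType) (n : nat) (e : rel 'I_n) :
  exists F, graded_free_resolution (@edge_ideal k n e) F.
Proof.
pose mon (s : 'I_#|edges e|) : 'X_{1..n} := (\sum_(i in enum_val s) U_(i))%MM.
have monE s : 'X_[mon s] = \prod_(i in enum_val s) 'X_i :> {mpoly k[n]}.
  by rewrite mprodXE.
exists (taylor_seq k mon).
have idealE (f : {mpoly k[n]}) : edge_ideal e f <-> monomial_ideal mon f.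
  split=> [[c ->]|[c ->]].
    exists (fun s => c (enum_val s)); rewrite [LHS]big_enum_val.
    by apply: eq_bigr => s _; rewrite monE.
  exists (fun S => \sum_(s | enum_val s == S) c s).
  rewrite [RHS]big_enum_val; apply: eq_bigr => s _.
  rewrite monE (big_pred1 s) // => t.
  exact: (inj_eq enum_val_inj).
case: (taylor_resolution k mon) => hd ha ho ea ed; split=> // f.
by split=> [/idealE/ho|/ho/idealE].
Qed.

(** * Dimensions of quotients of subspaces *)

Section QuotientDimension.

Variables (k : fieldType) (n : nat).
Local Notation R := {mpoly k[n]}.

Definition kcomb (M : lmodType R) d (b : 'I_d -> M) (c : 'I_d -> k) : M :=
  \sum_l (c l)%:MP *: b l.

(** Modules of forms are modules over [R]; the field [k] acts on them through
    the constant polynomials. *)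
Definition ksubspace (M : lmodType R) (U : M -> Prop) : Prop :=
  U 0 /\ forall (c : k) u v, U u -> U v -> U (c%:MP *: u + v).

(** The dimension of [U / V] over [k] is [d]. It is witnessed by a basis modulo
    [V], because the ambient modules have infinite dimension over [k]. *)
Definition has_qdim (M : lmodType R) (U V : M -> Prop) (d : nat) : Prop :=
  exists b : 'I_d -> M,
    [/\ forall l, U (b l),
        forall u, U u -> exists c, V (u - kcomb b c) &
        forall c, V (kcomb b c) -> forall l, c l = 0].

Lemma ksubspace_comb (M : lmodType R) (U : M -> Prop) d (b : 'I_d -> M) c :
  ksubspace U -> (forall l, U (b l)) -> U (kcomb b c).
Proof.
case=> U0 Uc Ub; rewrite /kcomb; apply: big_ind => // [u v Uu Uv|l _].
  by have := Uc 1 u v Uu Uv; rewrite scale1r.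
by rewrite -[_ *: _]addr0; apply: Uc.
Qed.

Lemma ksubspaceB (M : lmodType R) (U : M -> Prop) u v :
  ksubspace U -> U u -> U v -> U (u - v).
Proof.
case=> U0 Uc Uu Uv; have := Uc (-1) v u Uv Uu.
by rewrite mpolyCN scaleN1r addrC.
Qed.

Lemma kcomb_map (M M' : lmodType R) (f : {linear M -> M'}) d (b : 'I_d -> M) c :
  f (kcomb b c) = kcomb (fun l => f (b l)) c.
Proof. by rewrite linear_sum; apply: eq_bigr => l _; rewrite linearZ. Qed.

Lemma has_qdim_ext (M : lmodType R) (U V U' V' : M -> Prop) d :
  (forall x, U x <-> U' x) -> (forall x, V x <-> V' x) ->
  has_qdim U V d -> has_qdim U' V' d.
Proof.
move=> eqU eqV [b [Ub bgen bfree]]; exists b; split=> [l|u|c].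
- exact/eqU.
- by move=> /eqU/bgen[c Vc]; exists c; apply/eqV.
by move=> /eqV/bfree.
Qed.

(** [f] induces an isomorphism from [U / V] to [U' / V']. *)
Record quotient_iso (M M' : lmodType R) (f : {linear M -> M'})
    (U V : M -> Prop) (U' V' : M' -> Prop) : Prop := {
  qiso_num : forall u, U u -> U' (f u);
  qiso_den : forall v, V v -> V' (f v);
  qiso_onto : forall u', U' u' -> exists2 u, U u & f u = u';
  qiso_inj : forall u, U u -> V' (f u) -> V u
}.

Lemma quotient_iso_qdim (M M' : lmodType R) (f : {linear M -> M'})
    (U V : M -> Prop) (U' V' : M' -> Prop) d :
  ksubspace U -> quotient_iso f U V U' V' ->
  has_qdim U V d <-> has_qdim U' V' d.
Proof.
move=> sU [fU fV fonto finj]; split=> [[b [Ub bgen bfree]]|[b' [Ub' b'gen b'free]]].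
  exists (fun l => f (b l)); split=> [l|u' /fonto[u Uu <-]|c]; first exact: fU.
    have [c Vc] := bgen u Uu; exists c.
    by rewrite -kcomb_map -linearB; apply: fV.
  rewrite -kcomb_map => Vc; apply: bfree; apply: finj => //.
  exact: ksubspace_comb.
have pre l : {u | U u /\ f u = b' l}.
  apply: constructive_indefinite_description.
  by have [u Uu fu] := fonto _ (Ub' l); exists u.
pose b l := sval (pre l).
have Ub l : U (b l) by case: (svalP (pre l)).
have fb c : f (kcomb b c) = kcomb b' c.
  rewrite kcomb_map; apply: eq_bigr => l _.
  by rewrite (proj2 (svalP (pre l))).
exists b; split=> // [u Uu|c /fV]; last by rewrite fb; apply: b'free.
have [c Vc] := b'gen _ (fU _ Uu); exists c; apply: finj.
  by apply: ksubspaceB => //; apply: ksubspace_comb.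
by rewrite linearB fb.
Qed.

(** Two bases express each other modulo [V] by matrices [C] and [C'] with
    [C * C' = 1]. *)
Lemma has_qdim_le (M : lmodType R) (U V : M -> Prop) d d' :
  ksubspace V -> has_qdim U V d -> has_qdim U V d' -> (d <= d')%N.
Proof.
move=> sV [b [Ub bgen bfree]] [b' [Ub' b'gen b'free]].
have coef (w : M) (m : nat) (v : 'I_m -> M) :
    (forall u, U u -> exists c, V (u - kcomb v c)) -> U w ->
    {c | V (w - kcomb v c)}.
  by move=> gen Uw; apply: constructive_indefinite_description; apply: gen.
pose C l := sval (coef _ _ _ b'gen (Ub l)).
pose C' l := sval (coef _ _ _ bgen (Ub' l)).
have VC l : V (b l - kcomb b' (C l)) by apply: svalP (coef _ _ _ b'gen (Ub l)).
have VC' l : V (b' l - kcomb b (C' l)) by apply: svalP (coef _ _ _ bgen (Ub' l)).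
suff : (\matrix_(l < d, t < d') C l t) *m (\matrix_(t < d', l < d) C' t l)
       = 1%:M by move/mulmx1_min.
apply/matrixP=> l l0; rewrite !mxE.
pose c l0 := \sum_t C l t * C' t l0 - (l == l0)%:R.
suff /(_ l0)/eqP : forall l0, c l0 = 0.
  rewrite subr_eq0 => /eqP <-; apply: eq_bigr => t _; by rewrite !mxE.
apply: bfree.
have -> : kcomb b c = - ((b l - kcomb b' (C l)) +
    kcomb (fun t => b' t - kcomb b (C' t)) (C l)).
  have -> : kcomb (fun t => b' t - kcomb b (C' t)) (C l) =
      kcomb b' (C l) - kcomb b (fun l0 => \sum_t C l t * C' t l0).
    rewrite /kcomb; under eq_bigr do rewrite scalerBr scaler_sumr.
    rewrite sumrB exchange_big; congr (_ - _); apply: eq_bigr => l1 _.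
    rewrite rmorph_sum scaler_suml; apply: eq_bigr => t _.
    by rewrite scalerA rmorphM.
  rewrite addrA subrK opprB.
  have -> : b l = kcomb b (fun l0 => (l == l0)%:R).
    rewrite /kcomb (bigD1 l) //= eqxx scale1r big1 ?addr0 // => i.
    by rewrite eq_sym => /negPf->; rewrite mpolyC0 scale0r.
  by rewrite -sumrB; apply: eq_bigr => i _; rewrite -scalerBl -mpolyCB.
rewrite -[- _]add0r; apply: ksubspaceB => //; first by case: sV.
have [_ VD] := sV; rewrite -[_ - _ + _]scale1r.
rewrite scalerDr [1 *: kcomb _ _]scale1r.
apply: VD => //; exact: ksubspace_comb.
Qed.

End QuotientDimension.

(** * The Koszul complex and the double complex of a resolution *)

Section Koszul.

Variables (k : fieldType) (n : nat).
Local Notation R := {mpoly k[n]}.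
Local Notation forms r := {ffun {set 'I_n} -> 'rV[R]_r}.
Local Notation kos := (tay_diff (fun i : 'I_n => U_(i)%MM)).

Lemma mlcms_varsE (A : {set 'I_n}) v :
  mlcms (fun i : 'I_n => U_(i)%MM) A v = (v \in A).
Proof.
rewrite mnmE; have [Av|nAv] := boolP (v \in A).
  rewrite (bigD1 v) //= mnm1E eqxx big1 // => i /andP[_ /negPf].
  by rewrite mnm1E => ->.
by rewrite big1 // => i Ai; rewrite mnm1E; case: eqP => // ei; rewrite -ei Ai in nAv.
Qed.

Lemma mdeg_mlcms_vars (A : {set 'I_n}) :
  mdeg (mlcms (fun i : 'I_n => U_(i)%MM) A) = #|A|.
Proof.
rewrite mdegE -sum1_card [RHS]big_mkcond; apply: eq_bigr => v _.
by rewrite mlcms_varsE.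
Qed.

(** [x] is a [p]-form, homogeneous of total degree [j], with values in the
    graded free module whose basis vectors have the degrees [d]. *)
Definition homog_form r (d : 'I_r -> nat) (p j : nat) (x : forms r) : Prop :=
  forall A a m, m \in msupp (x A 0 a) -> #|A| = p /\ (mdeg m + d a + p)%N = j.

(** The second condition is the augmentation to [k] at the [0]-forms; with it,
    cycles are boundaries in every degree. *)
Definition koszul_cycle r (x : forms r) : Prop :=
  kos x = 0 /\ forall a, (x set0 0 a)@_0 = 0.

Definition mxpush r r' (D : 'M[R]_(r, r')) (x : forms r) : forms r' :=
  [ffun A => x A *m D].

Definition homog_mx r r' (d : 'I_r -> nat) (d' : 'I_r' -> nat)
    (D : 'M[R]_(r, r')) : Prop :=
  forall a b m, m \in msupp (D a b) -> (mdeg m + d' b)%N = d a.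

Lemma mxpush_is_linear r r' (D : 'M[R]_(r, r')) : linear (mxpush D).
Proof.
by move=> c x y; apply/ffunP=> A; rewrite !ffunE mulmxDl scalemxAl.
Qed.

HB.instance Definition _ r r' (D : 'M[R]_(r, r')) :=
  GRing.isLinear.Build R (forms r) (forms r') *:%R
    (mxpush D) (mxpush_is_linear D).

Lemma mxpush_koszul r r' (D : 'M[R]_(r, r')) x :
  mxpush D (kos x) = kos (mxpush D x).
Proof.
apply/ffunP=> A; rewrite !ffunE mulmx_suml; apply: eq_bigr => i _.
by rewrite ffunE scalemxAl.
Qed.

Lemma ksubspace_homog r (d : 'I_r -> nat) p j :
  @ksubspace k n (forms r) (homog_form d p j).
Proof.
split=> [A a m|c x y hx hy A a m]; first by rewrite ffunE mxE msupp0.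
rewrite !ffunE !mxE => /msuppD_le; rewrite mem_cat => /orP[|/hy//].
by rewrite mul_mpolyC => /msuppZ_le/hx.
Qed.

Lemma ksubspace_koszul_cycle r : @ksubspace k n (forms r) (@koszul_cycle r).
Proof.
split=> [|c x y [dx x0] [dy y0]].
  by split=> [|a]; [exact: raddf0 | rewrite ffunE mxE mcoeff0].
split=> [|a]; first by rewrite tay_diff_is_linear dx dy scaler0 addr0.
by rewrite !ffunE !mxE mcoeffD mcoeffCM x0 y0 mulr0 addr0.
Qed.

Lemma msupp_mulmx r r' (v : 'rV[R]_r) (D : 'M[R]_(r, r')) b m :
  m \in msupp ((v *m D) 0 b) ->
  exists a m1 m2, [/\ m1 \in msupp (v 0 a), m2 \in msupp (D a b) &
                      m = (m1 + m2)%MM].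
Proof.
rewrite mxE => /msupp_sum_le/flatten_mapP[a _] /=.
by move=> /msuppM_le/allpairsP[[m1 m2] /= [vm1 Dm2 ->]]; exists a, m1, m2.
Qed.

Lemma homog_mxpush r r' (d : 'I_r -> nat) (d' : 'I_r' -> nat) D p j x :
  homog_mx d d' D -> homog_form d p j x -> homog_form d' p j (mxpush D x).
Proof.
move=> hD hx A b m; rewrite ffunE => /msupp_mulmx[a [m1 [m2 [xm1 Dm2 ->]]]].
have [-> <-] := hx _ _ _ xm1; rewrite -(hD _ _ _ Dm2) mdegD; split=> //; lia.
Qed.

Lemma homog_koszul r (d : 'I_r -> nat) p j x :
  homog_form d p.+1 j x -> homog_form d p j (kos x).
Proof.
move=> hx A a m /msupp_tay_diff[i [m' [niA xm' em]]].
have [] := hx _ _ _ xm'; rewrite cardsU1 niA add1n => -[cA] <-; split=> //.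
have /(congr1 (@mdeg n)) := em; rewrite !mdegD !mdeg_mlcms_vars cardsU1 niA add1n cA.
lia.
Qed.

(** Homogeneous elements of the image of a homogeneous map have homogeneous
    preimages: the terms of the wrong degree contribute nothing. *)
Lemma homog_lift r r' (d : 'I_r -> nat) (d' : 'I_r' -> nat) D p j y :
  homog_mx d d' D -> homog_form d' p j (mxpush D y) ->
  exists2 y', homog_form d p j y' & mxpush D y = mxpush D y'.
Proof.
move=> hD hDy.
pose good (A : {set 'I_n}) a (m : 'X_{1..n}) :=
  (#|A| == p) && ((mdeg m + d a + p)%N == j).
pose y' : forms r := [ffun A => \row_a divide_terms (good A a) 0 (y A 0 a)].
have y'E A a m : (y' A 0 a)@_m = if good A a m then (y A 0 a)@_m else 0.
  by rewrite ffunE mxE mcoeff_divide_terms addm0.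
have hy' : homog_form d p j y'.
  move=> A a m; rewrite mcoeff_msupp y'E.
  by case: ifP => [/andP[/eqP-> /eqP->]//|_]; rewrite eqxx.
exists y' => //; apply/eqP; rewrite -subr_eq0 -raddfB /=; apply/eqP.
apply/ffunP=> A; apply/rowP=> b; apply/mpolyP=> m.
rewrite [in RHS]ffunE [in RHS]mxE mcoeff0.
have [/andP[sA /eqP gm]|bad_m] :=
  boolP ((#|A| == p) && ((mdeg m + d' b + p)%N == j)).
  apply/memN_msupp_eq0/negP; rewrite ffunE.
  move=> /msupp_mulmx[a [m1 [m2 [ym1 Dm2 em]]]]; move: ym1.
  rewrite mcoeff_msupp !ffunE !mxE mcoeffB mcoeff_divide_terms addm0 /good sA.
  rewrite ifT ?subrr ?eqxx //=; apply/eqP.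
  by rewrite -gm em mdegD -(hD _ _ _ Dm2); lia.
have zero z : homog_form d' p j z -> (z A 0 b)@_m = 0.
  move=> hz; apply/memN_msupp_eq0/negP=> /hz[sA gm].
  by case/negP: bad_m; rewrite sA gm !eqxx.
have eq_r : mxpush D (y - y') = mxpush D y - mxpush D y' by rewrite raddfB.
rewrite eq_r !ffunE !mxE mcoeffB.
have := zero _ hDy; have := zero _ (homog_mxpush hD hy').
by rewrite !ffunE !mxE => -> ->; rewrite subrr.
Qed.

(** Exactness of the Koszul complex of a free module, in every degree: it is
    the Taylor complex of the variables, and a [0]-form without constant term
    only has monomials divisible by a variable. *)
Lemma koszul_lift r (d : 'I_r -> nat) p j x :
  homog_form d p j x -> koszul_cycle x ->
  exists2 y, homog_form d p.+1 j y & kos y = x.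
Proof.
move=> hx [dx x0]; exists (cone (fun i : 'I_n => U_(i)%MM) x).
  move=> A a m /msupp_cone[s [m' [As xm' em]]].
  have [sA gm'] := hx _ _ _ xm'; split; first by rewrite (cardsD1 s) As sA.
  have /(congr1 (@mdeg n)) := em.
  rewrite !mdegD !mdeg_mlcms_vars (cardsD1 s A) As -gm' sA; lia.
apply: tay_diff_cone => // a m xm.
have m_neq0 : m != 0%MM by apply: contraTneq xm => ->; rewrite -mcoeff_eq0 x0.
have [i nz|all0] := pickP (fun i => m i != 0%N).
  exists i; apply/mnm_lepP=> v; rewrite mnm1E.
  by case: eqP => // <-; rewrite lt0n.
case/eqP: m_neq0; apply/mnmP=> v; rewrite mnm0E.
by have := all0 v => /negbFE/eqP.
Qed.

Section DoubleComplex.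

Variables (I : R -> Prop) (F : free_seq k n).
Hypotheses (resF : graded_free_resolution I F).
Hypothesis (I_const0 : forall f, I f -> f@_0 = 0).
Variable j : nat.

(** The augmented resolution, with [R] itself at level [0] and [F_q] at level
    [q.+1]. *)
Definition level_rk q := if q is q'.+1 then rk F q' else 1%N.

Definition level_deg q : 'I_(level_rk q) -> nat :=
  match q with 0 => fun=> 0%N | q'.+1 => @gdeg k n F q' end.

Definition level_dif q : 'M[R]_(level_rk q.+1, level_rk q) :=
  match q with 0 => aug F | q'.+1 => dif F q' end.

Local Notation push q := (mxpush (level_dif q)).
Local Notation hform q p := (homog_form (@level_deg q) p j).

Lemma level_dif_homog q :
  homog_mx (@level_deg q.+1) (@level_deg q) (level_dif q).
Proof.
case: q => [|q] a b m /=; last by move=> Dm; apply: (dif_homog resF); rewrite mxE.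
by rewrite ord1 addn0 => /(dhomogP _ _ _ (aug_homog resF a)).
Qed.

(** Exactness of [F] holds for rows of polynomials, hence for forms
    coefficientwise; homogeneity of the lift is [homog_lift]. *)
Lemma level_exact q p (x : forms (level_rk q.+1)) :
  hform q.+1 p x -> push q x = 0 ->
  exists2 y, hform q.+2 p y & push q.+1 y = x.
Proof.
move=> hx Dx0.
have ex_w (A : {set 'I_n}) :
    exists w : 'rV[R]_(level_rk q.+2), x A = w *m level_dif q.+1.
  have xA0 : x A *m level_dif q = 0.
    by have := congr1 (fun z : forms _ => z A) Dx0; rewrite !ffunE.
  case: q {hx Dx0} x xA0 => [|q] x xA0; first exact/(exact_aug resF).
  exact/(exact_dif resF).
have [w wE] := fin_all_exists ex_w.
have yx : push q.+1 (finfun w) = x by apply/ffunP=> A; rewrite !ffunE -wE.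
have [|y hy yE] := homog_lift (@level_dif_homog q.+1) (y := finfun w) (p := p) (j := j).
  by rewrite yx.
by exists y => //; rewrite -yE.
Qed.

Lemma level_difK q (y : forms (level_rk q.+2)) : push q (push q.+1 y) = 0.
Proof.
apply/ffunP=> A; rewrite !ffunE; case: q y => [|q] y.
  by apply/(exact_aug resF); exists (y A).
by apply/(exact_dif resF); exists (y A).
Qed.

(** The double complex has the [p]-forms with values at level [q] as entry
    [(q, p)], with the two commuting differentials [push] and [kos]. At each
    entry there are two subquotients: the receptor, elements killed by both
    differentials modulo images of the diagonal map, and the donor, elements
    killed by the diagonal map modulo the images of both differentials.
    Elements killed by [push] are written as images under [push], so that at
    level [0] the receptor consists of forms with values in [I]. *)
Definition receptor_num q p (x : forms (level_rk q)) : Prop :=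
  koszul_cycle x /\ exists2 y, hform q.+1 p y & push q y = x.

Definition receptor_den q p (x : forms (level_rk q)) : Prop :=
  exists2 y, hform q.+1 p.+1 y & kos (push q y) = x.

Definition donor_num q p (y : forms (level_rk q.+1)) : Prop :=
  hform q.+1 p y /\ koszul_cycle (push q y).

Definition donor_den q p (y : forms (level_rk q.+1)) : Prop :=
  exists z w, [/\ hform q.+2 p z, hform q.+1 p.+1 w &
                  y = push q.+1 z + kos w].

Lemma ksubspace_donor_num q p : @ksubspace k n _ (@donor_num q p).
Proof.
have [h0 hc] := ksubspace_homog (@level_deg q.+1) p j.
have [c0 cc] := @ksubspace_koszul_cycle (level_rk q).
split; first by split=> //; rewrite raddf0.
by move=> c u v [hu cu] [hv cv]; split; [apply: hc|rewrite mxpush_is_linear; apply: cc].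
Qed.

Lemma hform_sub q p x y : hform q p x -> hform q p y -> hform q p (x - y).
Proof. exact: (ksubspaceB (ksubspace_homog _ _ _)). Qed.

(** Exactness of the rows: [push] carries the donor at one entry isomorphically
    to the receptor at the entry one level below. *)
Lemma donor_to_receptor q p :
  quotient_iso (push q) (@donor_num q p) (@donor_den q p)
    (@receptor_num q p) (@receptor_den q p).
Proof.
split.
- by move=> y [hy cy]; split=> //; exists y.
- move=> y [z [w [hz hw ->]]]; exists w => //.
  by rewrite raddfD /= level_difK add0r mxpush_koszul.
- by move=> x [cx [y hy yx]]; exists y => //; split; rewrite // yx.
move=> y [hy cy] [w hw eq_yw].
have [||z hz zE] := @level_exact q p (y - kos w).
- by apply: hform_sub => //; apply: homog_koszul.
- by rewrite raddfB /= mxpush_koszul eq_yw subrr.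
by exists z, w; rewrite zE subrK.
Qed.

Lemma koszul_cycle_form q p (x : forms (level_rk q)) :
  hform q p.+1 x -> kos x = 0 -> koszul_cycle x.
Proof.
move=> hx dx; split=> // a; apply/memN_msupp_eq0/negP=> /hx[].
by rewrite cards0.
Qed.

Lemma koszul_cycle_boundary r (y : forms r) : koszul_cycle (kos y).
Proof.
split=> [|a]; first exact: tay_diffK.
apply/memN_msupp_eq0/negP=> /msupp_tay_diff[i [m [ni _ em]]].
have /(congr1 (@mdeg n)) := em.
by rewrite !mdegD !mdeg_mlcms_vars cardsU1 ni cards0 mdeg0; lia.
Qed.

Definition koszul_linear r : {linear forms r -> forms r} :=
  @tay_diff k n n (fun i : 'I_n => U_(i)%MM) r.

(** Exactness of the columns: [kos] carries the donor at one entry isomorphically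
    to the receptor at the forms of one degree less. *)
Lemma donor_to_receptor_koszul q p :
  quotient_iso (koszul_linear (level_rk q.+1))
    (@donor_num q p.+1) (@donor_den q p.+1)
    (@receptor_num q.+1 p) (@receptor_den q.+1 p).
Proof.
split.
- move=> y [hy [dy _]]; split; first exact: koszul_cycle_boundary.
  apply: level_exact; first exact: homog_koszul.
  by rewrite mxpush_koszul.
- move=> y [z [w [hz hw ->]]]; exists z => //.
  by rewrite [RHS](raddfD (koszul_linear _)) /= tay_diffK addr0.
- move=> x [cx [z hz zx]]; have hx : hform q.+1 p x.
    by rewrite -zx; apply: homog_mxpush hz; apply: level_dif_homog.
  have [y hy yx] := koszul_lift hx cx; exists y => //; split=> //.
  apply: koszul_cycle_form; first exact: homog_mxpush (@level_dif_homog q) hy.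
  by rewrite -mxpush_koszul yx -zx level_difK.
move=> y [hy _] [w hw eq_yw].
have hyw : hform q.+1 p.+1 (y - push q.+1 w).
  by apply: hform_sub hy _; apply: homog_mxpush (@level_dif_homog q.+1) hw.
have [|z hz zE] := koszul_lift hyw.
  apply: koszul_cycle_form hyw _.
  by rewrite [LHS](raddfB (koszul_linear _)) /= eq_yw subrr.
by exists w, z; rewrite zE addrC subrK.
Qed.

(** Alternating the two isomorphisms, one descends from level [q.+1] to level
    [0], while the degree of the forms rises from [p] to [p + q]. *)
Lemma donor_qdim q p d :
  has_qdim (@donor_num q p) (@donor_den q p) d ->
  has_qdim (@receptor_num 0 (p + q)) (@receptor_den 0 (p + q)) d.
Proof.
elim: q p => [|q IHq] p dq.
  rewrite addn0; apply/(quotient_iso_qdim _ _ (donor_to_receptor 0 p)) => //.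
  exact: ksubspace_donor_num.
rewrite addnS -addSn; apply: IHq.
apply/(quotient_iso_qdim _ _ (donor_to_receptor_koszul q p)).
  exact: ksubspace_donor_num.
apply/(quotient_iso_qdim _ _ (donor_to_receptor q.+1 p)) => //.
exact: ksubspace_donor_num.
Qed.

(** On [0]-forms, reduction modulo the variables, which takes a term of [F] to its
    tensor product with [k]. *)
Definition const_row q (y : forms (level_rk q)) : 'rV[k]_(level_rk q) :=
  map_mx (mcoeff 0%MM) (y set0).

Definition const_form q (v : 'rV[k]_(level_rk q)) : forms (level_rk q) :=
  [ffun A : {set 'I_n} => if A == set0 then map_mx (@mpolyC n k) v else 0].

Lemma const_rowK q : cancel (@const_form q) (@const_row q).
Proof.
move=> v; apply/rowP=> a; rewrite mxE ffunE eqxx mxE mcoeffC eqxx.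
by rewrite mulr1.
Qed.

Lemma const_row_push q (y : forms (level_rk q.+1)) :
  const_row (push q y) = const_row y *m map_mx (mcoeff 0%MM) (level_dif q).
Proof. by rewrite /const_row ffunE map_mxM. Qed.

Lemma const_rowD q (x y : forms (level_rk q)) :
  const_row (x + y) = const_row x + const_row y.
Proof. by apply/rowP=> a; rewrite !mxE ffunE mxE mcoeffD. Qed.

Lemma const_rowN q (x : forms (level_rk q)) : const_row (- x) = - const_row x.
Proof. by apply/rowP=> a; rewrite !mxE ffunE mxE mcoeffN. Qed.

Lemma const_row_boundary q (w : forms (level_rk q)) : const_row (kos w) = 0.
Proof.
have [_ w0] := koszul_cycle_boundary w.
by apply/rowP=> a; rewrite !mxE w0.
Qed.

Lemma deg_partP i (v : 'rV[k]_(rk F i)) :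
  reflect (forall a, v 0 a != 0 -> gdeg F i a = j) (v <= deg_part F i j)%MS.
Proof.
apply: (iffP idP) => [/submxP[u ->] a|hv].
  rewrite mul_mx_diag !mxE; case: (gdeg F i a =P j) => // _.
  by rewrite mulr0 eqxx.
apply/submxP; exists v; apply/rowP=> a; rewrite mul_mx_diag !mxE.
case: (gdeg F i a =P j) => [_|nj]; first by rewrite mulr1.
rewrite mulr0; apply/eqP; apply: contra_notT nj; exact: hv.
Qed.

Lemma const_row_deg i (y : forms (level_rk i.+1)) :
  hform i.+1 0 y -> (const_row y <= deg_part F i j)%MS.
Proof.
move=> hy; apply/deg_partP=> a; rewrite mxE -mcoeff_msupp => /hy[_ <-].
by rewrite mdeg0 addn0.
Qed.

Lemma hform_const i (v : 'rV[k]_(rk F i)) :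
  (v <= deg_part F i j)%MS -> hform i.+1 0 (@const_form i.+1 v).
Proof.
move=> /deg_partP hv A a m; rewrite ffunE.
case: eqP => [->|_]; last by rewrite mxE msupp0.
rewrite mxE mcoeff_msupp mcoeffC; case: (m =P 0%MM) => [->|_]; last first.
  by rewrite mulr0 eqxx.
by rewrite mulr1 cards0 mdeg0 addn0 => /hv.
Qed.

Lemma koszul_cycle0 q (x : forms (level_rk q)) :
  hform q 0 x -> koszul_cycle x <-> const_row x = 0.
Proof.
move=> hx; split=> [[_ x0]|x0].
  by apply/rowP=> a; rewrite !mxE x0.
split=> [|a]; last by have /rowP/(_ a) := x0; rewrite !mxE.
apply/ffunP=> B; apply/rowP=> a; rewrite [in RHS]ffunE [in RHS]mxE.
apply/msuppnil0; case E: (msupp _) => [//|m s].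
have /msupp_tay_diff[i [m' [niB /hx[sA _] _]]] : m \in msupp (kos x B 0 a).
  by rewrite E mem_head.
by move: sA; rewrite cardsU1 niB.
Qed.

Lemma aug_const0 : map_mx (mcoeff 0%MM) (aug F) = 0.
Proof.
apply/matrixP=> a c; rewrite ord1 !mxE; apply: I_const0.
apply/(aug_onto resF); exists (delta_mx 0 a); by rewrite -rowE mxE.
Qed.

(** Modulo the variables, the donor at the [0]-forms is the homology of [F]
    tensored with [k]: cycles correspond to numerators here, and boundaries
    to denominators in [donor_den0P]. *)
Lemma donor_num0P i (y : forms (level_rk i.+1)) : hform i.+1 0 y ->
  donor_num 0 y <-> (const_row y <= cycles F i j)%MS.
Proof.
move=> hy; have hDy := homog_mxpush (@level_dif_homog i) hy.
have -> : donor_num 0 y <-> const_row (push i y) = 0.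
  by split=> [[_ /koszul_cycle0->//]|/koszul_cycle0 cy]; split=> //; exact: cy.
rewrite const_row_push; case: i y hy {hDy} => [|i] y hy /=.
  by rewrite aug_const0 mulmx0; split=> // _; apply: const_row_deg.
rewrite sub_capmx (const_row_deg hy); split=> [cy|/sub_kermxP//].
exact/sub_kermxP.
Qed.

Lemma donor_den0P i (y : forms (level_rk i.+1)) : hform i.+1 0 y ->
  donor_den 0 y <-> (const_row y <= boundaries F i j)%MS.
Proof.
move=> hy; split=> [[z [w [hz hw ->]]]|/submxP[u cy]].
  rewrite const_rowD const_row_boundary addr0 const_row_push.
  by have /submxP[u ->] := const_row_deg hz; rewrite -mulmxA submxMl.
pose z : forms (level_rk i.+2) := @const_form i.+2 (u *m deg_part F i.+1 j).
have hz : hform i.+2 0 z by apply: hform_const; apply: submxMl.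
have hyz : hform i.+1 0 (y - push i.+1 z).
  by apply: hform_sub hy _; apply: homog_mxpush (@level_dif_homog i.+1) hz.
have [|w hw wE] := koszul_lift hyz.
  apply/(koszul_cycle0 hyz).
  rewrite const_rowD const_rowN const_row_push const_rowK cy.
  by rewrite /boundaries mulmxA subrr.
by exists z, w; rewrite wE addrC subrK.
Qed.

Lemma boundaries_sub_cycles i : (boundaries F i j <= cycles F i j)%MS.
Proof.
apply/row_subP=> a; rewrite row_mul.
pose v := row a (deg_part F i.+1 j).
have hz : hform i.+2 0 (@const_form i.+2 v) by apply/hform_const/row_sub.
have hDz := homog_mxpush (@level_dif_homog i.+1) hz.
have := const_row_push (@const_form i.+2 v).
rewrite const_rowK => <-; apply/(donor_num0P hDz); split=> //.
by rewrite level_difK; case: (@ksubspace_koszul_cycle (level_rk i)).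
Qed.

(** A complement of the boundaries in the cycles, lifted to constant forms, is a
    basis of the donor. *)
Lemma donor_qdim_tor i :
  has_qdim (@donor_num i 0) (@donor_den i 0) (tor_dim F i j).
Proof.
have -> : tor_dim F i j = \rank (cycles F i j :\: boundaries F i j)%MS.
  rewrite /tor_dim -(mxrank_cap_compl (cycles F i j) (boundaries F i j)).
  by rewrite (capmx_idPr (boundaries_sub_cycles i)) addKn.
set CB := (_ :\: _)%MS; pose W := row_base CB.
have WC : (W <= cycles F i j)%MS by rewrite eq_row_base diffmxSl.
pose b l : forms (level_rk i.+1) := @const_form i.+1 (row l W).
have hW (c : 'rV_(\rank CB)) : hform i.+1 0 (@const_form i.+1 (c *m W)).
  apply: hform_const; apply: submx_trans (submxMl _ _) (submx_trans WC _).
  by case: (i) => //= i'; apply: capmxSl.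
have combE c : kcomb b c = @const_form i.+1 (\row_l c l *m W).
  apply/ffunP=> A; rewrite sum_ffunE ffunE.
  case: (A =P set0) => [->|/eqP nA]; last first.
    by rewrite big1 // => l _; rewrite !ffunE (negPf nA) scaler0.
  apply/rowP=> a; rewrite summxE !mxE rmorph_sum; apply: eq_bigr => l _.
  by rewrite !ffunE eqxx !mxE rmorphM.
exists b; split.
- move=> l; have -> : b l = @const_form i.+1 (delta_mx 0 l *m W).
    by rewrite -rowE.
  apply/(donor_num0P (hW _)); rewrite const_rowK.
  exact: submx_trans (submxMl _ _) WC.
- move=> u Uu; have [hu _] := Uu.
  have : (const_row u <= CB + cycles F i j :&: boundaries F i j)%MS.
    by rewrite addsmx_diff_cap_eq; apply/(donor_num0P hu).
  case/sub_addsmxP=> -[u1 u2] /= eu.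
  have /submxP[c ec] : (u1 *m CB <= W)%MS by rewrite eq_row_base submxMl.
  exists (fun l => c 0 l); rewrite combE.
  have -> : \row_l c 0 l = c by apply/rowP=> l; rewrite mxE.
  have huc := hform_sub hu (hW c).
  apply/(donor_den0P huc); rewrite const_rowD const_rowN const_rowK eu ec.
  by rewrite addrAC subrr add0r; apply: submx_trans (submxMl _ _) (capmxSr _ _).
move=> c; rewrite combE => /(donor_den0P (hW _)); rewrite const_rowK => cB l.
have : (\row_l c l *m W <= CB :&: boundaries F i j)%MS.
  by rewrite sub_capmx cB -(eq_row_base CB) submxMl.
rewrite capmx_diff submx0 => /eqP cW0.
have /rowP/(_ l) : \row_l c l = 0.
  by apply: (row_free_inj (row_base_free CB)); rewrite cW0 mul0mx.
by rewrite !mxE.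
Qed.

(** The balance of [Tor]: the homology of [F] tensored with [k], at one edge of
    the double complex, agrees with the Koszul homology of [I] at the other
    edge. *)
Lemma tor_koszul_qdim i :
  has_qdim (@receptor_num 0 i) (@receptor_den 0 i) (tor_dim F i j).
Proof. by have := donor_qdim (donor_qdim_tor i); rewrite add0n. Qed.

End DoubleComplex.

End Koszul.

(** * Cycles with quadratic values in the edge ideal *)

Lemma addU_inj (n : nat) (a b c d : 'I_n) :
  (U_(a) + U_(b))%MM = (U_(c) + U_(d))%MM ->
  (a = c /\ b = d) \/ (a = d /\ b = c).
Proof.
move=> eq_m; have := (mnmP _ _).1 eq_m c; rewrite !mnmDE !mnm1E eqxx.
have [ac|_] := eqVneq a c.
  by move: eq_m; rewrite ac => /addmI/eqP; rewrite eq_mnm1 => /eqP->; left.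
have [bc|//] := eqVneq b c.
by move: eq_m; rewrite bc addmC => /addmI/eqP; rewrite eq_mnm1 => /eqP->; right.
Qed.

Section LinearStrand.

Variables (k : fieldType) (n : nat) (e : rel 'I_n).
Hypotheses (e_sym : ssrbool.symmetric e) (e_irr : irreflexive e).
Local Notation R := {mpoly k[n]}.
Local Notation forms := {ffun {set 'I_n} -> 'rV[R]_1}.
Local Notation kos := (tay_diff (fun i : 'I_n => U_(i)%MM)).
Local Notation I := (@edge_ideal k n e).
Implicit Types (A B S W : {set 'I_n}) (a b v w r t : 'I_n) (x : forms).

Lemma mem_edges a b : e a b -> [set a; b] \in edges e.
Proof. by move=> eab; apply/imsetP; exists (a, b); rewrite ?inE. Qed.

Lemma edgesP S : S \in edges e -> exists a b, e a b /\ S = [set a; b].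
Proof. by case/imsetP=> -[a b]; rewrite inE /= => eab ->; exists a, b. Qed.

Lemma edge_neq a b : e a b -> a != b.
Proof. by apply: contraTneq => ->; rewrite e_irr. Qed.

Lemma edge_prodX a b : e a b ->
  \prod_(i in [set a; b]) 'X_i = 'X_[U_(a) + U_(b)] :> R.
Proof.
move=> eab; rewrite big_setU1 ?inE ?edge_neq //= big_set1.
by rewrite mpolyXD.
Qed.

Lemma msupp_edge_ideal f m : I f -> m \in msupp f ->
  exists a b, e a b /\ (U_(a) + U_(b) <= m)%MM.
Proof.
move=> [c ->] /msupp_sum_le/flatten_mapP[S]; rewrite mem_filter => /andP[ES _].
have [a [b [eab eS]]] := edgesP ES; rewrite /= {2}eS edge_prodX //.
move=> /msuppM_le/allpairsP[[m1 m2] /= [_ /mem_msuppXP <- ->]].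
by exists a, b; split; rewrite // lem_addl.
Qed.

Lemma edge_ideal_XX (c : R) a b : e a b -> I (c * 'X_[U_(a) + U_(b)]).
Proof.
move=> eab; exists (fun S => if S == [set a; b] then c else 0).
rewrite (bigD1 [set a; b]) ?mem_edges //= eqxx edge_prodX // big1 ?addr0 //.
by move=> S /andP[_ /negPf->]; rewrite mul0r.
Qed.

Lemma edge_ideal0 : I 0.
Proof. by exists (fun=> 0); rewrite big1 // => S _; rewrite mul0r. Qed.

Lemma edge_idealD f g : I f -> I g -> I (f + g).
Proof.
move=> [c ->] [d ->]; exists (fun S => c S + d S).
by rewrite -big_split; apply: eq_bigr => S _; rewrite mulrDl.
Qed.

Lemma edge_idealM (c : R) f : I f -> I (c * f).
Proof.
move=> [d ->]; exists (fun S => c * d S).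
by rewrite big_distrr; apply: eq_bigr => S _ /=; rewrite mulrA.
Qed.

Lemma edge_ideal_const0 f : I f -> f@_0 = 0.
Proof.
move=> If; apply/memN_msupp_eq0/negP=> /(msupp_edge_ideal If)[a [b [_ le0]]].
by have := mnm_lepP le0 a; rewrite mnmDE mnm1E mnm0E eqxx.
Qed.

(** The total degree [i + 2] forces the values of these [i]-forms to be
    quadratic. *)
Definition edge_cycle i x : Prop :=
  [/\ koszul_cycle x, homog_form (fun=> 0%N) i (i + 2) x &
      forall A, I (x A 0 0)].

Lemma ksubspace_edge_cycle i : @ksubspace k n forms (edge_cycle i).
Proof.
have [c0 cc] := @ksubspace_koszul_cycle k n 1.
have [h0 hc] := @ksubspace_homog k n 1 (fun=> 0%N) i (i + 2).
split; first by split=> // A; rewrite ffunE mxE; apply: edge_ideal0.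
move=> c u v [cu hu Iu] [cv hv Iv]; split; [exact: cc|exact: hc|move=> A].
by rewrite !ffunE !mxE; apply: edge_idealD => //; apply: edge_idealM.
Qed.

(** In degree [i + 2] there are no boundaries: they would come from forms with
    linear values, and the edge ideal has no linear elements. *)
Lemma tor_edge_cycle F i : graded_free_resolution I F ->
  has_qdim (edge_cycle i) (fun x : forms => x = 0) (tor_dim F i (i + 2)).
Proof.
move=> resF.
have Dhom := @level_dif_homog k n I F resF 0.
apply: has_qdim_ext (tor_koszul_qdim resF edge_ideal_const0 (i + 2) i) => x.
  split=> [[cx [y hy yx]]|[cx hx Ix]].
    split=> // [|A]; first by rewrite -yx; apply: homog_mxpush Dhom hy.
    by apply/(aug_onto resF); exists (y A); rewrite -yx ffunE.
  split=> //; have [w wE] := fin_all_exists (fun A => (aug_onto resF _).1 (Ix A)).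
  pose y : {ffun {set 'I_n} -> 'rV[R]_(level_rk F 1)} := finfun w.
  have yx : mxpush (level_dif F 0) y = x.
    by apply/ffunP=> A; apply/rowP=> c; rewrite ord1 !ffunE wE.
  have [|y' hy' eq_y] := homog_lift Dhom (y := y) (p := i) (j := i + 2).
    by rewrite yx.
  by exists y'; rewrite // -eq_y.
split=> [[y hy <-]|->].
  have -> : mxpush (level_dif F 0) y = 0; last exact: raddf0.
  apply/ffunP=> A; apply/rowP=> c; rewrite ord1 [in RHS]ffunE [in RHS]mxE.
  apply/msuppnil0; case E: (msupp _) => [//|m s].
  have := mem_head m s; rewrite -E => ym.
  have [_] := homog_mxpush Dhom hy ym; rewrite addn0 => gm.
  have [|a [b [_ /mnm_lepP le_abm]]] := @msupp_edge_ideal _ m _ ym.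
    by apply/(aug_onto resF); exists (y A); rewrite ffunE.
  have : (mdeg (U_(a) + U_(b)) <= mdeg m)%N.
    by rewrite !mdegE; apply: leq_sum => t _.
  by rewrite mdegD !mdeg1; lia.
exists 0; first by case: (@ksubspace_homog k n _ (@level_deg k n F 1) i.+1 (i + 2)).
by rewrite [X in kos X]raddf0 raddf0.
Qed.

Lemma kos_coef x B m : (kos x B 0 0)@_m =
  \sum_(t | (t \notin B) && (0 < m t)%N)
    (-1) ^+ below t B * (x (t |: B) 0 0)@_(m - U_(t)).
Proof.
have := @mdcoef_diff k n n (fun i : 'I_n => U_(i)%MM) 1
  (m + mlcms (fun i : 'I_n => U_(i)%MM) B) x B 0 (lem_addl _ _).
rewrite {1}/mdcoef lem_addl addmK => ->; rewrite [RHS]big_mkcondr.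
apply: eq_bigr => t ntB; rewrite /mdcoef.
have -> : mlcms (fun i : 'I_n => U_(i)%MM) (t |: B)
    = (U_(t) + mlcms (fun i : 'I_n => U_(i)%MM) B)%MM.
  apply/mnmP=> v; rewrite mnmDE mnm1E !mlcms_varsE !inE eq_sym.
  by case: eqP => //= <-; rewrite (negPf ntB).
have -> : (U_(t) + mlcms (fun i : 'I_n => U_(i)) B <=
           m + mlcms (fun i : 'I_n => U_(i)) B)%MM = (0 < m t)%N.
  apply/mnm_lepP/idP => [/(_ t)|mt v]; rewrite !mnmDE leq_add2r mnm1E.
    by rewrite eqxx.
  by case: eqP => // <-.
case: ifP => [mt|_]; last by rewrite mulr0.
congr (_ * _@__); apply/mnmP=> v.
by rewrite !(mnmBE, mnmDE) mnm1E subnDr.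
Qed.

Lemma edge_cycle_supp i x A m : edge_cycle i x -> (x A 0 0)@_m != 0 ->
  #|A| = i /\ exists a b, e a b /\ m = (U_(a) + U_(b))%MM.
Proof.
move=> [_ hx Ix] xm; have [|sA gm] := hx A 0 m; first by rewrite mcoeff_msupp.
split=> //; have [|a [b [eab le_abm]]] := @msupp_edge_ideal _ m (Ix A).
  by rewrite mcoeff_msupp.
exists a, b; split=> //; have em := submK le_abm.
have /eqP : mdeg (m - (U_(a) + U_(b)))%MM = 0%N.
  have /(congr1 (@mdeg n)) := em; rewrite !mdegD !mdeg1; lia.
by rewrite mdeg_eq0 => /eqP m0; rewrite -em m0 add0m.
Qed.

Lemma edge_cycle_diff i x B m : edge_cycle i x -> (kos x B 0 0)@_m = 0.
Proof. by move=> [[-> _] _ _]; rewrite ffunE mxE mcoeff0. Qed.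

Lemma edge_cycle_nonedge i x A a b : edge_cycle i x -> ~~ e a b ->
  (x A 0 0)@_(U_(a) + U_(b)) = 0.
Proof.
move=> cx nab; apply/eqP; apply: contraTT isT => /(edge_cycle_supp cx)[_].
case=> c [d [ecd /addU_inj[[ac bd]|[ad bc]]]]; case/negP: nab.
  by rewrite ac bd.
by rewrite ad bc e_sym.
Qed.

(** Multidegrees that are not squarefree contribute nothing. The differential
    at [A :\ a], in the monomial with [a] twice and [b] once, involves only
    this coefficient and that of the square of [a], which is not an edge. *)
Lemma edge_cycle_overlap i x A a b : edge_cycle i x -> a \in A -> e a b ->
  (x A 0 0)@_(U_(a) + U_(b)) = 0.
Proof.
move=> cx Aa eab; have := edge_cycle_diff (A :\ a) (U_(a) + (U_(a) + U_(b)))%MM cx.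
rewrite kos_coef (bigD1 a) /=; last by rewrite !inE !mnmDE !mnm1E !eqxx.
rewrite setD1K // [(U_(a) + _)%MM]addmC addmK big1 ?addr0.
  by move/eqP; rewrite mulf_eq0 signr_eq0 => /eqP.
move=> t /andP[/andP[_ mt] ne_ta].
have et : t = b.
  move: mt; rewrite !mnmDE !mnm1E eq_sym (negPf ne_ta).
  by case: eqP.
rewrite et [(U_(a) + U_(b))%MM]addmC -addmA addmC addmK.
rewrite (edge_cycle_nonedge _ cx) ?mulr0 //.
by rewrite e_irr.
Qed.

(** In the squarefree multidegree [S], a cycle is the coboundary of a function
    on [S], defined up to a constant: the relation says that this function
    takes the same value at [p] and [q]. *)
Definition equipotential x S p q : bool :=
  (p == q) || ((x (S :\ p :\ q) 0 0)@_(U_(p) + U_(q)) == 0).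

Lemma equipotential_sym x S p q : equipotential x S p q = equipotential x S q p.
Proof. by rewrite /equipotential eq_sym setDDl setUC -setDDl addmC. Qed.

(** The cycle condition is the cocycle condition on the triangle [p q s]. Only
    the vanishing of its three terms is compared, so the signs do not
    matter. *)
Lemma equipotential_trans i x S p q s : edge_cycle i x ->
  p \in S -> q \in S -> s \in S ->
  equipotential x S p q -> equipotential x S q s -> equipotential x S p s.
Proof.
move=> cx Sp Sq Ss; rewrite /equipotential.
have [->//|pq] := eqVneq p q; have [->|qs] := eqVneq q s.
  by move=> /= -> _; rewrite orbT.
have [//|ps /= /eqP xpq /eqP xqs] := eqVneq p s.
pose B := S :\ p :\ q :\ s; pose m := (U_(p) + (U_(q) + U_(s)))%MM.
have := edge_cycle_diff B m cx; rewrite kos_coef (bigD1 q) /=; last first.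
  by rewrite !inE !mnmDE !mnm1E !eqxx /= andbF addnC.
have -> : q |: B = S :\ p :\ s.
  apply/setP=> t; rewrite !inE; have [->|] := eqVneq t q; last by [].
  by rewrite Sq (negPf qs) eq_sym pq.
have -> : (m - U_(q) = U_(p) + U_(s))%MM.
  by rewrite /m addmA [(U_(p) + _)%MM]addmC -addmA [(U_(q) + _)%MM]addmC addmK.
rewrite big1 ?addr0; first by move/eqP; rewrite mulf_eq0 signr_eq0.
move=> t /andP[/andP[_ mt] ne_tq].
have [->|ne_tp] := eqVneq t p.
  have -> : p |: B = S :\ q :\ s.
    apply/setP=> u; rewrite !inE; have [->|] := eqVneq u p; last by [].
    by rewrite Sp pq ps.
  by rewrite /m addmC addmK xqs mulr0.
have et : t = s.
  by move: mt; rewrite !mnmDE !mnm1E ![_ == t]eq_sym (negPf ne_tp)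
    (negPf ne_tq); case: eqP.
have -> : t |: B = S :\ p :\ q.
  apply/setP=> u; rewrite et !inE; have [->|] := eqVneq u s; last by [].
  by rewrite Ss eq_sym qs eq_sym ps.
by rewrite /m et addmA addmK xpq mulr0.
Qed.

(** * Stars as a basis of the cycles *)

Definition dominates S v : bool := [forall w in S, (w != v) ==> e v w].

(** The vertex of [S] at which the potential is normalized to [0]. It is chosen
    among the vertices with a non-neighbor in [S] whenever there is one, since
    the potential should be constant on these vertices. *)
Definition root S : option 'I_n :=
  if [pick v in S | ~~ dominates S v] is Some v then Some v else [pick v in S].

Lemma rootP S : S != set0 ->
  exists r, [/\ root S = Some r, r \in S &
                dominates S r -> {in S, forall v, dominates S v}].
Proof.
move=> S0; rewrite /root; case: pickP => [r /andP[Sr nfr]|all_full].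
  by exists r; split=> // fr; rewrite fr in nfr.
case: pickP => [r Sr|none].
  exists r; split=> // _ v Sv; have := all_full v.
  by rewrite Sv /= => /negbFE.
by case/set0Pn: S0 => v; rewrite none.
Qed.

Definition is_star i (q : 'I_n * {set 'I_n}) : bool :=
  (#|q.2| == i + 1)%N && [forall w in q.2, e q.1 w].

(** The stars centered at the root of their vertex set are left out. Such a star
    exists only on a clique [S], where the signed sum of all the stars on [S]
    is [d(d(e_S)) = 0]. *)
Definition star_basis i : {set 'I_n * {set 'I_n}} :=
  [set q | is_star i q && (root (q.1 |: q.2) != Some q.1)].

(** The absence of induced [4]-cycles, localized to the vertex sets that index
    the multidegrees of total degree [i + 2]. *)
Definition C4_free_at i : Prop :=
  forall S, #|S| = (i + 2)%N ->
  forall p q r s, p \in S -> q \in S -> r \in S -> s \in S ->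
  p != r -> q != s -> e p q -> e q r -> e r s -> e s p -> e p r || e q s.

(** The coordinate of a cycle at the star [q], up to sign: the potential at the
    center of [q], in the normalization given by the root. *)
Definition star_coord x (q : 'I_n * {set 'I_n}) : k :=
  if root (q.1 |: q.2) is Some r then
    (x (q.2 :\ r) 0 0)@_(U_(r) + U_(q.1)) else 0.

(** A cycle is determined by its coordinates at the stars. These say that the
    potential on [S] vanishes at every vertex that dominates [S]; it remains
    to see that the other vertices are equipotential, for which non-adjacent
    vertices suffice: two vertices with non-neighbors [r'] and [p'] are linked
    through these unless the four of them form an induced [4]-cycle. *)
Lemma edge_cycle_eq0 i x : C4_free_at i -> edge_cycle i x ->
  (forall q, q \in star_basis i -> star_coord x q = 0) -> x = 0.
Proof.
move=> C4 cx coord0; apply/ffunP=> A; apply/rowP=> c; rewrite ord1.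
rewrite [in RHS]ffunE [in RHS]mxE; apply/mpolyP=> m; rewrite mcoeff0.
apply/eqP; apply: contraTT isT => nz.
have [sA [a [b [eab em]]]] := edge_cycle_supp cx nz; case/negP: nz.
rewrite {}em; have [Aa|nAa] := boolP (a \in A).
  by rewrite (edge_cycle_overlap cx).
have [Ab|nAb] := boolP (b \in A).
  by rewrite addmC (edge_cycle_overlap cx) // e_sym.
pose S := a |: (b |: A).
have sS : #|S| = (i + 2)%N.
  by rewrite !cardsU1 !inE (negPf nAa) nAb (negPf (edge_neq eab)) sA !add1n addn2.
have Sa : a \in S by rewrite !inE eqxx.
have Sb : b \in S by rewrite !inE eqxx orbT.
have S0 : S != set0 by apply/set0Pn; exists a.
have [r [rootS Sr full_r]] := rootP S0.
have trans p q s := @equipotential_trans i x S p q s cx.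
have nonedge p q : ~~ e p q -> equipotential x S p q.
  by move=> npq; rewrite /equipotential (edge_cycle_nonedge _ cx) ?eqxx ?orbT.
have root_eq p : p \in S -> equipotential x S r p.
  move=> Sp; have [<-|ne_rp] := eqVneq r p; first by rewrite /equipotential eqxx.
  have [fp|nfp] := boolP (dominates S p).
    have SpK : p |: (S :\ p) = S by rewrite setD1K.
    have := coord0 (p, S :\ p); rewrite /star_coord /= SpK rootS => coord_p.
    rewrite /equipotential setDDl setUC -setDDl coord_p ?eqxx ?orbT //.
    rewrite inE /is_star /= SpK rootS.
    have -> : (Some r != Some p) by apply: contra_neq ne_rp => -[].
    have := cardsD1 p S; rewrite Sp sS addn2 add1n => -[<-].
    rewrite addn1 eqxx andbT; apply/forallP=> w; apply/implyP=> /setD1P[wp Sw].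
    by have /forallP/(_ w) := fp; rewrite Sw wp.
  have witness v : ~~ dominates S v -> exists w, [/\ w \in S, w != v & ~~ e v w].
    by rewrite negb_forall => /existsP[w]; rewrite !negb_imply => /and3P[]; exists w.
  have nfr : ~~ dominates S r by apply: contra nfp => fr; apply: full_r.
  have [r' [Sr' ne_r' nrr']] := witness r nfr.
  have [p' [Sp' ne_p' npp']] := witness p nfp.
  have [erp|/nonedge//] := boolP (e r p).
  have pp' := nonedge p p' npp'; have rr' := nonedge r r' nrr'.
  have [epr'|npr'] := boolP (e p r'); last first.
    by apply: (trans _ r') => //; rewrite equipotential_sym nonedge.
  have [erp'|nrp'] := boolP (e r p'); last first.
    apply: (trans _ p') => //; first exact: nonedge.
    by rewrite equipotential_sym.
  have [er'p'|nr'p'] := boolP (e r' p'); last first.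
    apply: (trans _ r') => //; apply: (trans _ p') => //; first exact: nonedge.
    by rewrite equipotential_sym.
  (* otherwise [r], [p], [r'], [p'] form an induced [4]-cycle *)
  have := C4 S sS r p r' p' Sr Sp Sr' Sp'.
  rewrite eq_sym ne_r' eq_sym ne_p' erp epr' er'p' e_sym erp'.
  by rewrite (negPf nrr') (negPf npp') => /(_ isT isT isT isT isT isT).
have : equipotential x S a b.
  by apply: (trans a r b) => //; [rewrite equipotential_sym|]; apply: root_eq.
rewrite /equipotential (negPf (edge_neq eab)) /= => /eqP <-; apply/eqP.
congr (x _ 0 0)@__; apply/setP=> t; rewrite !inE.
have [->|_] := eqVneq t a; first by rewrite andbF (negPf nAa).
by have [->|//] := eqVneq t b; rewrite (negPf nAb).
Qed.

Definition monomial_form v W : forms :=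
  [ffun A => if A == W then const_mx 'X_v else 0].

(** The cycle [ 'X_v * d(e_W) ] supported on the star with center [v] and
    leaves [W]. *)
Definition star (q : 'I_n * {set 'I_n}) : forms := kos (monomial_form q.1 q.2).

Lemma star_coef v W A m : (star (v, W) A 0 0)@_m =
  \sum_(t | [&& t \notin A, t |: A == W & m == (U_(t) + U_(v))%MM])
    (-1) ^+ below t A.
Proof.
rewrite kos_coef big_mkcond [RHS]big_mkcond; apply: eq_bigr => t _ /=.
case: (t \notin A) => //=; rewrite ffunE.
case: (_ == W) => /=; last by rewrite mxE mcoeff0 mulr0 if_same.
rewrite mxE mcoeffX; have [->|ne_m] := eqVneq m (U_(t) + U_(v))%MM.
  by rewrite mnmDE mnm1E eqxx add1n addmC addmK eqxx mulr1.
case: ifP => // mt; case: eqP => [ev|]; last by rewrite mulr0.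
case/eqP: ne_m; rewrite ev addmC submK //.
by apply/mnm_lepP=> u; rewrite mnm1E; case: eqP => // <-.
Qed.

Lemma msupp_star v W A m : m \in msupp (star (v, W) A 0 0) ->
  exists t, [/\ t \notin A, t |: A = W & m = (U_(t) + U_(v))%MM].
Proof.
rewrite mcoeff_msupp star_coef.
case: (pickP (fun t => [&& t \notin A, t |: A == W &
    m == (U_(t) + U_(v))%MM])) => [t /and3P[nAt /eqP eW /eqP em] _|none].
  by exists t.
by rewrite big_pred0 // eqxx.
Qed.

Lemma edge_ideal_supp f :
  (forall m, m \in msupp f -> exists a b, e a b /\ m = (U_(a) + U_(b))%MM) ->
  I f.
Proof.
move=> supp_f; rewrite (mpolyE f) big_seq.
apply: big_ind => [|g h|m /supp_f[a [b [eab ->]]]]; first exact: edge_ideal0.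
  exact: edge_idealD.
by rewrite -mul_mpolyC; apply: edge_ideal_XX.
Qed.

Lemma star_edge_cycle i q : is_star i q -> edge_cycle i (star q).
Proof.
case: q => v W /andP[/eqP sW /= /forallP NW]; split.
- exact: koszul_cycle_boundary.
- apply: homog_koszul => A a m; rewrite ffunE.
  case: eqP => [->|_]; last by rewrite mxE msupp0.
  by rewrite mxE => /mem_msuppXP <-; rewrite mdeg1 sW addn1; split=> //; lia.
move=> A; apply: edge_ideal_supp => m /msupp_star[t [_ eW ->]].
exists t, v; split=> //; rewrite e_sym; apply: (implyP (NW t)).
by rewrite -eW setU11.
Qed.

Definition star_sign (q : 'I_n * {set 'I_n}) : k :=
  if root (q.1 |: q.2) is Some r then (-1) ^+ below r (q.2 :\ r) else 0.

Lemma star_basisP i v W : (v, W) \in star_basis i ->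
  exists r, [/\ root (v |: W) = Some r, r != v, r \in W & v \notin W].
Proof.
rewrite inE /= => /andP[/andP[_ /= /forallP NW] nroot].
have [|r [rootS Sr _]] := @rootP (v |: W).
  by apply/set0Pn; exists v; rewrite setU11.
have rv : r != v by apply: contraNneq nroot => rv; rewrite rootS rv.
exists r; split=> //; first by move: Sr; rewrite !inE (negPf rv).
by apply/negP=> Wv; have := NW v; rewrite Wv e_irr.
Qed.

(** The coordinates are dual, up to signs, to the stars of the basis. Two distinct stars
    share a monomial with its index set only if they have the same vertex set
    [S] and that monomial is the edge between their centers; the monomials
    read by the coordinates are edges at the root of [S], which is not a
    center. *)
Lemma star_coord_star i p q : p \in star_basis i -> q \in star_basis i ->
  star_coord (star p) q = if p == q then star_sign q else 0.
Proof.
case: p q => v' W' [v W] Qp Qq; have [r [rootS rv Wr nWv]] := star_basisP Qq.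
rewrite /star_coord /star_sign /= rootS star_coef xpair_eqE.
case: eqP => [->|ne_v] /=; last first.
  rewrite big_pred0 // => t; apply/negP=> /and3P[_ /eqP eW /eqP/addU_inj[]].
    by case=> _ /esym.
  case=> erv' evt; have : root (v' |: W') = Some v'.
    rewrite -eW -erv' -rootS -evt setUCA; congr root; congr (_ |: _).
    exact: setD1K.
  by move=> root'; move: Qp; rewrite inE /= root' eqxx andbF.
have tE t : (U_(r) + U_(v) == U_(t) + U_(v))%MM = (t == r).
  by rewrite eqm_add2r eq_mnm1 eq_sym.
case: eqP => [->|ne_W].
  rewrite (big_pred1 r) // => t; rewrite tE; have [->|] := eqVneq t r.
    by rewrite !inE eqxx setD1K // eqxx.
  by rewrite !andbF => /negPf /= ->.
rewrite big_pred0 // => t; rewrite tE; have [->|] := eqVneq t r.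
  rewrite setD1K //; case: (W =P W') => [eW|_]; first by rewrite eW in ne_W.
  by rewrite andbF.
by rewrite !andbF.
Qed.

Lemma star_coord_linear (c : k) x y q :
  star_coord (c%:MP *: x + y) q = c * star_coord x q + star_coord y q.
Proof.
rewrite /star_coord; case: (root _) => [r|]; last by rewrite mulr0 addr0.
by rewrite !ffunE !mxE mcoeffD mcoeffCM.
Qed.

Lemma star_coord0 q : star_coord 0 q = 0.
Proof.
by rewrite /star_coord; case: (root _) => // r; rewrite ffunE mxE mcoeff0.
Qed.

Lemma star_coordB x y q : star_coord (x - y) q = star_coord x q - star_coord y q.
Proof.
have := star_coord_linear (-1) y x q.
by rewrite mpolyCN scaleN1r mulN1r addrC => ->; rewrite addrC.
Qed.

Lemma star_coord_comb d (b : 'I_d -> forms) c q :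
  star_coord (kcomb b c) q = \sum_l c l * star_coord (b l) q.
Proof.
apply: (big_ind2 (fun x y => star_coord x q = y)) => [|x u y w <- <-|l _].
- exact: star_coord0.
- by rewrite -[x]scale1r star_coord_linear mul1r scale1r.
by rewrite -[_ *: _]addr0 star_coord_linear star_coord0 addr0.
Qed.

Lemma star_sign_sqr i q : q \in star_basis i -> star_sign q * star_sign q = 1.
Proof.
case: q => v W /star_basisP[r [rootS _ _ _]].
by rewrite /star_sign rootS -expr2 sqrr_sign.
Qed.

Lemma edge_cycle_qdim i : C4_free_at i ->
  has_qdim (edge_cycle i) (fun x : forms => x = 0) #|star_basis i|.
Proof.
move=> C4; pose b (l : 'I_#|star_basis i|) := star (enum_val l).
have Ub l : edge_cycle i (b l).
  apply: star_edge_cycle; have := enum_valP l.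
  by rewrite inE => /andP[].
have coord_comb c l0 : star_coord (kcomb b c) (enum_val l0)
    = c l0 * star_sign (enum_val l0).
  rewrite star_coord_comb (bigD1 l0) //= (star_coord_star (enum_valP _) (enum_valP _)).
  rewrite eqxx big1 ?addr0 // => l ne_l.
  rewrite (star_coord_star (enum_valP _) (enum_valP _)).
  by rewrite (inj_eq enum_val_inj) (negPf ne_l) mulr0.
exists b; split=> // [u Uu|c comb0 l]; last first.
  have := coord_comb c l; rewrite comb0 star_coord0.
  move/(congr1 ( *%R^~ (star_sign (enum_val l)))).
  by rewrite /= mul0r -mulrA (star_sign_sqr (enum_valP l)) mulr1.
exists (fun l => star_coord u (enum_val l) * star_sign (enum_val l)).
apply: (edge_cycle_eq0 C4).
  apply: ksubspaceB Uu _; first exact: ksubspace_edge_cycle.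
  by apply: ksubspace_comb => //; apply: ksubspace_edge_cycle.
move=> q Qq; rewrite star_coordB -(enum_rankK_in Qq Qq) coord_comb -mulrA.
by rewrite (star_sign_sqr (enum_valP _)) mulr1 subrr.
Qed.

(** * Induced 4-cycles, cliques and the number of stars *)

Lemma C4_free_all : no_induced_C4 e -> forall i, C4_free_at i.
Proof.
move=> noC4 i S _ p q r s _ _ _ _ pr qs epq eqr ers esp.
apply: contraT; rewrite negb_or => /andP[npr nqs].
pose f := [ffun x : 'I_4 => nth p [:: p; q; r; s] x].
have uniq_f : uniq [:: p; q; r; s].
  rewrite /= !inE !negb_or pr qs (edge_neq epq) (edge_neq eqr) (edge_neq ers).
  by rewrite eq_sym (edge_neq esp).
have inj_f : injective f.
  by move=> x y; rewrite !ffunE => /eqP; rewrite nth_uniq // => /eqP/val_inj.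
have card_f : #|f @: [set: 'I_4]| = 4.
  by rewrite card_imset // cardsT card_ord.
case/negP: (noC4 _ card_f); apply/existsP; exists f; apply/and3P; split=> //.
  exact/injectiveP.
have [eqp erq] : e q p /\ e r q by rewrite ![e _ q]e_sym e_sym.
have [esr eps] : e s r /\ e p s by rewrite e_sym [e p s]e_sym.
have [nrp nsq] : ~~ e r p /\ ~~ e s q by rewrite e_sym [e s q]e_sym.
apply/forallP=> -[x lx]; apply/forallP=> -[y ly]; rewrite !ffunE /=.
rewrite /cycle4 -!val_eqE /=.
case: x lx => [|[|[|[|//]]]] _; case: y ly => [|[|[|[|//]]]] _;
  by rewrite /= ?e_irr ?epq ?eqr ?ers ?esp ?eqp ?erq ?esr ?eps
    ?(negPf npr) ?(negPf nqs) ?(negPf nrp) ?(negPf nsq).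
Qed.

Lemma C4_free_small i : (i <= 1)%N -> C4_free_at i.
Proof.
move=> i1 S sS p q r s Sp Sq Sr Ss pr qs epq eqr ers esp.
have uniq_f : uniq [:: p; q; r; s].
  rewrite /= !inE !negb_or pr qs (edge_neq epq) (edge_neq eqr) (edge_neq ers).
  by rewrite eq_sym (edge_neq esp).
suff : (4 <= #|S|)%N by rewrite sS; move: i1; case: (i) => [|[|]].
have card4 : #|[:: p; q; r; s]| = 4%N := card_uniqP uniq_f.
rewrite -card4; apply/subset_leq_card/subsetP=> t.
by rewrite !inE => /or4P[] /eqP->.
Qed.

Definition nbhd v : {set 'I_n} := [set w | e v w].

Lemma card_nbhd v : #|nbhd v| = deg e v.
Proof.
have inj_f : injective (fun w => [set v; w]).
  move=> w w' /= eq_w; apply/eqP; have := set22 v w; rewrite eq_w !inE.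
  case: eqP => [ev|_ //]; have := set22 v w'; rewrite -eq_w !inE.
  by rewrite ev orbb eq_sym.
rewrite /deg -(card_imset _ inj_f); congr #|pred_of_set _|.
apply/setP=> S; rewrite inE; apply/imsetP/andP => [[w]|[ES Sv]].
  by rewrite inE => evw ->; rewrite mem_edges // !inE eqxx.
have [a [b [eab eS]]] := edgesP ES; move: Sv; rewrite eS !inE.
case/orP=> /eqP->; first by exists b; rewrite ?inE.
by exists a; rewrite ?inE 1?e_sym // setUC.
Qed.

Lemma is_clique S m : induced_iso e S (@complete m) =
  (#|S| == m) && [forall v in S, dominates S v].
Proof.
apply/existsP/andP => [[f /and3P[/injectiveP inj_f /eqP <- /forallP ef]]|].
  split; first by rewrite card_imset // cardsT card_ord.
  apply/forallP=> v; apply/implyP=> /imsetP[x _ ->].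
  apply/forallP=> w; apply/implyP=> /imsetP[y _ ->]; apply/implyP=> ne_yx.
  have /forallP/(_ y)/eqP -> := ef x.
  by apply: contraNneq ne_yx => ->.
case=> /eqP sS /forallP clS; exists [ffun x => enum_val (cast_ord (esym sS) x)].
apply/and3P; split.
- by apply/injectiveP=> x y; rewrite !ffunE => /enum_val_inj/cast_ord_inj.
- apply/eqP/setP=> v; apply/imsetP/idP => [[x _ ->]|Sv].
    by rewrite ffunE; apply: enum_valP.
  exists (cast_ord sS (enum_rank_in Sv v)) => //.
  by rewrite ffunE cast_ordK enum_rankK_in.
apply/forallP=> x; apply/forallP=> y; rewrite !ffunE /complete.
have [->|ne_xy] := eqVneq x y; first by rewrite e_irr.
set a := cast_ord _ x; set b := cast_ord _ y.
have /implyP/(_ (enum_valP a))/forallP/(_ (enum_val b)) := clS (enum_val a).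
rewrite enum_valP /= (inj_eq enum_val_inj) (inj_eq (@cast_ord_inj _ _ _)).
by rewrite eq_sym ne_xy /= => ->.
Qed.

(** Stars with [i + 2] vertices are counted by their centers; those that are
    not in the basis have their root as center, which makes them cliques, and
    every clique has one root. *)
Lemma card_star_basis i :
  (#|star_basis i| + num_cliques e (i + 2))%N
    = (\sum_(v : 'I_n) 'C(deg e v, i + 1))%N.
Proof.
have -> : (\sum_(v : 'I_n) 'C(deg e v, i + 1))%N = #|[set q | is_star i q]|.
  rewrite -sum1_card (eq_bigl (fun q => xpredT q.1 && is_star i (q.1, q.2))).
    rewrite -(pair_big_dep xpredT (fun v W => is_star i (v, W)) (fun _ _ => 1%N)).
    apply: eq_bigr => v _; rewrite sum1_card -card_nbhd -cards_draws.
    apply: eq_card => W; rewrite !inE /is_star andbC /=; congr (_ && _).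
    apply/subsetP/forallP => [sub w|NW w Ww].
      by apply/implyP=> /sub; rewrite inE.
    by rewrite inE; apply: (implyP (NW w)).
  by case=> v W; rewrite inE.
rewrite -(cardsID [set q | root (q.1 |: q.2) == Some q.1] [set q | is_star i q]).
rewrite addnC; congr (_ + _)%N; last first.
  by apply: eq_card => q; rewrite !inE andbC.
rewrite /num_cliques -(card_in_imset (f := fun q => q.1 |: q.2)); last first.
  move=> [v W] [v' W']; rewrite !inE /=.
  move=> /andP[/andP[_ /= /forallP NW] /eqP rv] /andP[/andP[_ /= /forallP NW'] /eqP rv'].
  move=> eS; move: rv; rewrite eS rv' => -[ev]; rewrite ev in eS NW *.
  congr (_, _); rewrite -[W](setU1K (a := v)) ?eS ?setU1K //.
    by apply/negP=> Wv; have := NW' v; rewrite ?ev Wv e_irr.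
  by apply/negP=> Wv; have := NW v; rewrite Wv e_irr.
apply: eq_card => S; rewrite inE is_clique; apply/andP/imsetP => [[/eqP sS /forallP clS]|].
  have [|v [rootS Sv _]] := @rootP S.
    by rewrite -card_gt0 sS addn2.
  exists (v, S :\ v); rewrite /= ?setD1K // !inE /= setD1K // rootS eqxx andbT.
  have := cardsD1 v S; rewrite Sv sS addn2 add1n => -[card_W].
  rewrite /is_star /= -card_W addn1 eqxx; apply/forallP=> w; apply/implyP=> /setD1P[wv Sw].
  by have /implyP/(_ Sv)/forallP/(_ w) := clS v; rewrite Sw wv.
case=> -[v W]; rewrite !inE /= => /andP[/andP[/eqP sW /= /forallP NW] /eqP rootS] ->.
have nWv : v \notin W by apply/negP=> Wv; have := NW v; rewrite Wv e_irr.
split; first by rewrite cardsU1 nWv sW addn1 addn2.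
have [|r [rootS' _ clS]] := @rootP (v |: W).
  by apply/set0Pn; exists v; rewrite setU11.
move: rootS'; rewrite rootS => -[er].
apply/forallP=> u; apply/implyP; apply: clS; rewrite -er.
apply/forallP=> w; apply/implyP=> Sw; apply/implyP=> wv.
by apply: (implyP (NW w)); move: Sw; rewrite !inE (negPf wv).
Qed.

(** [graded_betti] is computed from some resolution; one exists, and all of them
    give the dimension of [edge_cycle i]. *)
Lemma betti_linear_strand i : C4_free_at i ->
  (graded_betti I i (i + 2))%:Z =
  (\sum_(v : 'I_n) 'C(deg e v, i + 1))%N%:Z - (num_cliques e (i + 2))%:Z.
Proof.
move=> C4.
have [F resF torF] : exists2 F : free_seq k n, graded_free_resolution I F &
    tor_dim F i (i + 2) = graded_betti I i (i + 2).
  pose computes (d : nat) := exists2 F : free_seq k n,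
    graded_free_resolution I F & tor_dim F i (i + 2) = d.
  have [F resF] := edge_ideal_resolution k e.
  apply: (epsilon_spec (inhabits 0%N) computes).
  by exists (tor_dim F i (i + 2)), F.
have dim_tor := tor_edge_cycle i resF; have dim_star := edge_cycle_qdim C4.
have sub0 : @ksubspace k n forms (fun x => x = 0).
  by split=> // c u v -> ->; rewrite scaler0 addr0.
have -> : graded_betti I i (i + 2) = #|star_basis i|.
  rewrite -torF; apply/eqP; rewrite eqn_leq.
  by rewrite (has_qdim_le sub0 dim_tor dim_star) (has_qdim_le sub0 dim_star dim_tor).
by rewrite -card_star_basis PoszD addrK.
Qed.

End LinearStrand.

Theorem proposition2p4 (k : fieldType) (n : nat) (e : rel 'I_n)
    (e_sym : ssrbool.symmetric e) (e_irr : irreflexive e) :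
  (no_induced_C4 e -> forall i : nat,
     (graded_betti (@edge_ideal k n e) i (i + 2))%:Z =
     (\sum_(v : 'I_n) 'C(deg e v, i + 1))%N%:Z - (num_cliques e (i + 2))%:Z)
  /\
  (forall i : nat, i = 0%N \/ i = 1%N ->
     (graded_betti (@edge_ideal k n e) i (i + 2))%:Z =
     (\sum_(v : 'I_n) 'C(deg e v, i + 1))%N%:Z - (num_cliques e (i + 2))%:Z).
Proof.
split=> [noC4 i|i small]; apply: betti_linear_strand => //.
  exact: C4_free_all.
by apply: C4_free_small => //; case: small => ->.
Qed.
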